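(* Let $C$ and $D$ be framed bicategories and let $F:D\to C$ be a strong framed functor. (1) Suppose $D$ is fully faithful. Then there exists a unique factorization of $F$ as a strong framed functor $\tilde F:D\to\tilde C$ followed by the inclusion strict framed functor $\tilde C\to C$. In particular, a sub-framed bicategory $D$ of a framed bicategory $C$ is fully faithful if and only if it is a sub-framed bicategory of $\tilde C$. (2) Suppose $D$ is absolutely dense. Then there exists a unique factorization of $F$ as a strong framed functor $\hat F:D\to\hat C$ followed by the inclusion strict framed functor $\hat C\to C$. A sub-framed bicategory $D$ of $C$ is absolutely dense if and only if $D$ is a sub-framed bicategory of $\hat C$.
   Context: **Double categories.** A double category $C$ has a category of objects and vertical morphisms $C_0$, a category of horizontal morphisms and squares $C_1$ (composition in $C_1$ is vertical composition of squares), left and right frame functors $L,R:C_1\to C_0$, a unit functor $U:C_0\to C_1$, and horizontal composition, which may be associative and unital only up to coherent globular isomorphism (a square is globular if its left and right frames are vertical identities). $U_f$ is the horizontal identity square of a vertical morphism $f$. **Framed bicategories.** A framed bicategory is a double category $C$ such that $L\times R:C_1\to C_0\times C_0$ is a bifibration; it is assumed throughout that $L\times R$ is a cloven and normal fibration (a choice of cartesian lifts is given, and the chosen lift along a pair of vertical identities is the identity square). Cartesian and opcartesian squares are those that are cartesian, respectively opcartesian, for $L\times R$. A strong framed functor between framed bicategories is a pseudo double functor (strict on vertical composition, preserving horizontal composition and units up to coherent invertible globular squares). A strict framed functor preserves horizontal composition and units strictly. **Fully faithful / absolutely dense.** A vertical morphism $f$ of a framed bicategory is fully faithful if $U_f$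 is cartesian, and absolutely dense if $U_f$ is opcartesian. A framed bicategory is fully faithful (absolutely dense) if every vertical morphism in it is fully faithful (absolutely dense). **$\tilde C$ and $\hat C$.** For a framed bicategory $C$, $\tilde C$ is the sub-double category of $C$ formed by the squares of $C$ whose left and right frames are fully faithful (so its vertical morphisms are the fully faithful vertical morphisms of $C$, and its objects and horizontal morphisms are those of $C$). $\hat C$ is defined in the same way with ''absolutely dense'' in place of ''fully faithful''. $\tilde C$ is a fully faithful framed bicategory and $\hat C$ is an absolutely dense framed bicategory. **Sub-framed bicategory.** A sub-framed bicategory of $C$ is a sub-double category of $C$ that is itself a framed bicategory.
   Formalization: For ''D sub-framed in C̃ (Ĉ) implies D fully faithful (absolutely dense)'', it is additionally assumed that if a globular square of D is invertible in C, its inverse lies in D; without this the implication fails for sub-double categories that are not full on squares. *)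

(* Defs.v *)
From Stdlib Require Import ProofIrrelevance.

Set Implicit Arguments.
Unset Strict Implicit.
Unset Printing Implicit Defensive.

(** A primitive record, so that [s] and [mk (val s) (prf s)] are convertible. *)
Set Primitive Projections.
Record sub (A : Type) (P : A -> Prop) : Type := mk { val : A; prf : P val }.
Unset Primitive Projections.
Arguments mk {A P} val prf.
Arguments val {A P} s.
Arguments prf {A P} s.

Lemma sub_eq (A : Type) (P : A -> Prop) (a b : sub P) : val a = val b -> a = b.
Proof.
destruct a as [a p], b as [b q]; simpl; intro e; destruct e.
now rewrite (proof_irrelevance _ p q).
Qed.

(** Composition is written in diagrammatic order throughout: [vcomp f g] is
    "first f, then g", and [hcomp M N] is the composite of [M : x -|-> y] and
    [N : y -|-> z].

    The category [C_0] has objects [ob] and morphisms [ver].  The category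
    [C_1] has as objects the horizontal morphisms and as morphisms from [M] to
    [M'] the squares [sq M M'] (top [M], bottom [M']); [lf] and [rf] are the
    actions on squares of the left and right frame functors, whose action on
    objects is built into the typing of [hor].  Horizontal composition is a
    functor on the pullback of [rf] and [lf]: [hsq a b e] takes a proof [e]
    that the frames match.  Every law below that mentions [hsq] is required for
    all such proofs. *)

Record DoubleCategory : Type := {
  ob : Type;
  ver : ob -> ob -> Type;
  vid : forall x, ver x x;
  vcomp : forall x y z, ver x y -> ver y z -> ver x z;
  vcomp_idl : forall x y (f : ver x y), vcomp (vid x) f = f;
  vcomp_idr : forall x y (f : ver x y), vcomp f (vid y) = f;
  vcomp_assoc : forall x y z w (f : ver x y) (g : ver y z) (h : ver z w),
    vcomp (vcomp f g) h = vcomp f (vcomp g h);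

  hor : ob -> ob -> Type;
  sq : forall x y x' y', hor x y -> hor x' y' -> Type;
  sid : forall x y (M : hor x y), sq M M;
  scomp : forall x y x' y' x'' y''
    (M : hor x y) (M' : hor x' y') (M'' : hor x'' y''),
    sq M M' -> sq M' M'' -> sq M M'';
  scomp_idl : forall x y x' y' (M : hor x y) (M' : hor x' y') (a : sq M M'),
    scomp (sid M) a = a;
  scomp_idr : forall x y x' y' (M : hor x y) (M' : hor x' y') (a : sq M M'),
    scomp a (sid M') = a;
  scomp_assoc : forall x0 y0 x1 y1 x2 y2 x3 y3 (M0 : hor x0 y0)
    (M1 : hor x1 y1) (M2 : hor x2 y2) (M3 : hor x3 y3)
    (a : sq M0 M1) (b : sq M1 M2) (c : sq M2 M3),
    scomp (scomp a b) c = scomp a (scomp b c);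

  lf : forall x y x' y' (M : hor x y) (M' : hor x' y'), sq M M' -> ver x x';
  rf : forall x y x' y' (M : hor x y) (M' : hor x' y'), sq M M' -> ver y y';
  lf_id : forall x y (M : hor x y), lf (sid M) = vid x;
  rf_id : forall x y (M : hor x y), rf (sid M) = vid y;
  lf_comp : forall x y x' y' x'' y''
    (M : hor x y) (M' : hor x' y') (M'' : hor x'' y'')
    (a : sq M M') (b : sq M' M''), lf (scomp a b) = vcomp (lf a) (lf b);
  rf_comp : forall x y x' y' x'' y''
    (M : hor x y) (M' : hor x' y') (M'' : hor x'' y'')
    (a : sq M M') (b : sq M' M''), rf (scomp a b) = vcomp (rf a) (rf b);

  hunit : forall x, hor x x;
  usq : forall x y, ver x y -> sq (hunit x) (hunit y);
  lf_usq : forall x y (f : ver x y), lf (usq f) = f;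
  rf_usq : forall x y (f : ver x y), rf (usq f) = f;
  usq_id : forall x, usq (vid x) = sid (hunit x);
  usq_comp : forall x y z (f : ver x y) (g : ver y z),
    usq (vcomp f g) = scomp (usq f) (usq g);

  hcomp : forall x y z, hor x y -> hor y z -> hor x z;
  hsq : forall x y z x' y' z' (M : hor x y) (N : hor y z)
    (M' : hor x' y') (N' : hor y' z') (a : sq M M') (b : sq N N'),
    rf a = lf b -> sq (hcomp M N) (hcomp M' N');
  lf_hsq : forall x y z x' y' z' (M : hor x y) (N : hor y z)
    (M' : hor x' y') (N' : hor y' z') (a : sq M M') (b : sq N N')
    (e : rf a = lf b), lf (hsq e) = lf a;
  rf_hsq : forall x y z x' y' z' (M : hor x y) (N : hor y z)
    (M' : hor x' y') (N' : hor y' z') (a : sq M M') (b : sq N N')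
    (e : rf a = lf b), rf (hsq e) = rf b;
  hsq_id : forall x y z (M : hor x y) (N : hor y z)
    (e : rf (sid M) = lf (sid N)), hsq e = sid (hcomp M N);
  hsq_comp : forall x y z x' y' z' x'' y'' z''
    (M : hor x y) (N : hor y z) (M' : hor x' y') (N' : hor y' z')
    (M'' : hor x'' y'') (N'' : hor y'' z'')
    (a : sq M M') (b : sq N N') (a' : sq M' M'') (b' : sq N' N'')
    (e : rf a = lf b) (e' : rf a' = lf b')
    (e'' : rf (scomp a a') = lf (scomp b b')),
    hsq e'' = scomp (hsq e) (hsq e');

  assoc : forall x y z w (M : hor x y) (N : hor y z) (P : hor z w),
    sq (hcomp (hcomp M N) P) (hcomp M (hcomp N P));
  lf_assoc : forall x y z w (M : hor x y) (N : hor y z) (P : hor z w),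
    lf (assoc M N P) = vid x;
  rf_assoc : forall x y z w (M : hor x y) (N : hor y z) (P : hor z w),
    rf (assoc M N P) = vid w;
  assoc_inv : forall x y z w (M : hor x y) (N : hor y z) (P : hor z w),
    exists b : sq (hcomp M (hcomp N P)) (hcomp (hcomp M N) P),
      scomp (assoc M N P) b = sid _ /\ scomp b (assoc M N P) = sid _;
  assoc_nat : forall x y z w x' y' z' w'
    (M : hor x y) (N : hor y z) (P : hor z w)
    (M' : hor x' y') (N' : hor y' z') (P' : hor z' w')
    (a : sq M M') (b : sq N N') (c : sq P P')
    (e1 : rf a = lf b) (e2 : rf (hsq e1) = lf c)
    (e3 : rf b = lf c) (e4 : rf a = lf (hsq e3)),
    scomp (hsq e2) (assoc M' N' P') = scomp (assoc M N P) (hsq e4);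

  lunit : forall x y (M : hor x y), sq (hcomp (hunit x) M) M;
  lf_lunit : forall x y (M : hor x y), lf (lunit M) = vid x;
  rf_lunit : forall x y (M : hor x y), rf (lunit M) = vid y;
  lunit_inv : forall x y (M : hor x y), exists b : sq M (hcomp (hunit x) M),
    scomp (lunit M) b = sid _ /\ scomp b (lunit M) = sid _;
  lunit_nat : forall x y x' y' (M : hor x y) (M' : hor x' y') (a : sq M M')
    (e : rf (usq (lf a)) = lf a),
    scomp (hsq e) (lunit M') = scomp (lunit M) a;

  runit : forall x y (M : hor x y), sq (hcomp M (hunit y)) M;
  lf_runit : forall x y (M : hor x y), lf (runit M) = vid x;
  rf_runit : forall x y (M : hor x y), rf (runit M) = vid y;
  runit_inv : forall x y (M : hor x y), exists b : sq M (hcomp M (hunit y)),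
    scomp (runit M) b = sid _ /\ scomp b (runit M) = sid _;
  runit_nat : forall x y x' y' (M : hor x y) (M' : hor x' y') (a : sq M M')
    (e : rf a = lf (usq (rf a))),
    scomp (hsq e) (runit M') = scomp (runit M) a;

  pentagon : forall v w x y z
    (M : hor v w) (N : hor w x) (P : hor x y) (Q : hor y z)
    (e1 : rf (assoc M N P) = lf (sid Q)) (e2 : rf (sid M) = lf (assoc N P Q)),
    scomp (hsq e1) (scomp (assoc M (hcomp N P) Q) (hsq e2))
    = scomp (assoc (hcomp M N) P Q) (assoc M N (hcomp P Q));
  triangle : forall x y z (M : hor x y) (N : hor y z)
    (e1 : rf (sid M) = lf (lunit N)) (e2 : rf (runit M) = lf (sid N)),
    scomp (assoc M (hunit y) N) (hsq e1) = hsq e2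
}.

Arguments ver {_}. Arguments vid {_}. Arguments vcomp {_ _ _ _}.
Arguments hor {_}. Arguments sq {_ _ _ _ _}. Arguments sid {_ _ _}.
Arguments scomp {_ _ _ _ _ _ _ _ _ _}.
Arguments lf {_ _ _ _ _ _ _}. Arguments rf {_ _ _ _ _ _ _}.
Arguments hunit {_}. Arguments usq {_ _ _}.
Arguments hcomp {_ _ _ _}. Arguments hsq {_ _ _ _ _ _ _ _ _ _ _}.
Arguments assoc {_ _ _ _ _}. Arguments lunit {_ _ _}. Arguments runit {_ _ _}.

Lemma hsq_congr (C : DoubleCategory) (x y z x' y' z' : ob C)
    (M : hor x y) (N : hor y z) (M' : hor x' y') (N' : hor y' z')
    (a a' : sq M M') (b b' : sq N N') (e : rf a = lf b) (e' : rf a' = lf b') :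
  a = a' -> b = b' -> hsq a b e = hsq a' b' e'.
Proof.
intros ea eb; subst a' b'; now rewrite (proof_irrelevance _ e e').
Qed.

Section Squares.
Context {C : DoubleCategory}.

Definition globular (x y : ob C) (M N : hor x y) (a : sq M N) : Prop :=
  lf a = vid x /\ rf a = vid y.

Definition inverse_squares (x y x' y' : ob C) (M : hor x y) (N : hor x' y')
    (a : sq M N) (b : sq N M) : Prop :=
  scomp a b = sid M /\ scomp b a = sid N.

Definition invertible (x y x' y' : ob C) (M : hor x y) (N : hor x' y')
    (a : sq M N) : Prop :=
  exists b : sq N M, inverse_squares a b.

(** (Op)cartesian morphisms of [C_1] for the functor [L x R : C_1 -> C_0 x C_0]. *)
Definition cartesian (x y z w : ob C) (M : hor x y) (N : hor z w)
    (a : sq M N) : Prop :=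
  forall (x' y' : ob C) (P : hor x' y') (b : sq P N)
    (u : ver x' x) (v : ver y' y),
    lf b = vcomp u (lf a) -> rf b = vcomp v (rf a) ->
    exists! c : sq P M, lf c = u /\ rf c = v /\ scomp c a = b.

Definition opcartesian (x y z w : ob C) (M : hor x y) (N : hor z w)
    (a : sq M N) : Prop :=
  forall (z' w' : ob C) (P : hor z' w') (b : sq M P)
    (u : ver z z') (v : ver w w'),
    lf b = vcomp (lf a) u -> rf b = vcomp (rf a) v ->
    exists! c : sq N P, lf c = u /\ rf c = v /\ scomp a c = b.

End Squares.

(** [restr_normal] is an equality in the type of all squares with bottom [N]. *)
Record Framing (C : DoubleCategory) : Type := {
  restr : forall x y z w : ob C, ver x z -> ver y w -> hor z w -> hor x y;
  restr_sq : forall (x y z w : ob C) (f : ver x z) (g : ver y w) (N : hor z w),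
    sq (restr f g N) N;
  lf_restr : forall (x y z w : ob C) (f : ver x z) (g : ver y w) (N : hor z w),
    lf (restr_sq f g N) = f;
  rf_restr : forall (x y z w : ob C) (f : ver x z) (g : ver y w) (N : hor z w),
    rf (restr_sq f g N) = g;
  restr_cartesian :
    forall (x y z w : ob C) (f : ver x z) (g : ver y w) (N : hor z w),
    cartesian (restr_sq f g N);
  restr_normal : forall (z w : ob C) (N : hor z w),
    existT (fun M : hor z w => sq M N)
      (restr (vid z) (vid w) N) (restr_sq (vid z) (vid w) N)
    = existT (fun M : hor z w => sq M N) N (sid N);
  opcartesian_lift :
    forall (x y z w : ob C) (f : ver x z) (g : ver y w) (M : hor x y),
    exists (N : hor z w) (a : sq M N), lf a = f /\ rf a = g /\ opcartesian a
}.

Record FramedBicategory : Type := {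
  dcat :> DoubleCategory;
  framing : Framing dcat
}.

Definition ff_ver (C : DoubleCategory) (x y : ob C) (f : ver x y) : Prop :=
  cartesian (usq f).

Definition ad_ver (C : DoubleCategory) (x y : ob C) (f : ver x y) : Prop :=
  opcartesian (usq f).

Definition fully_faithful (C : DoubleCategory) : Prop :=
  forall (x y : ob C) (f : ver x y), ff_ver f.

Definition absolutely_dense (C : DoubleCategory) : Prop :=
  forall (x y : ob C) (f : ver x y), ad_ver f.

Record DoubleFunctor (D C : DoubleCategory) : Type := {
  fob : ob D -> ob C;
  fver : forall x y : ob D, ver x y -> ver (fob x) (fob y);
  fver_id : forall x : ob D, fver (vid x) = vid (fob x);
  fver_comp : forall (x y z : ob D) (f : ver x y) (g : ver y z),
    fver (vcomp f g) = vcomp (fver f) (fver g);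
  fhor : forall x y : ob D, hor x y -> hor (fob x) (fob y);
  fsq : forall (x y x' y' : ob D) (M : hor x y) (M' : hor x' y'),
    sq M M' -> sq (fhor M) (fhor M');
  lf_fsq : forall (x y x' y' : ob D) (M : hor x y) (M' : hor x' y')
    (a : sq M M'), lf (fsq a) = fver (lf a);
  rf_fsq : forall (x y x' y' : ob D) (M : hor x y) (M' : hor x' y')
    (a : sq M M'), rf (fsq a) = fver (rf a);
  fsq_id : forall (x y : ob D) (M : hor x y), fsq (sid M) = sid (fhor M);
  fsq_comp : forall (x y x' y' x'' y'' : ob D)
    (M : hor x y) (M' : hor x' y') (M'' : hor x'' y'')
    (a : sq M M') (b : sq M' M''), fsq (scomp a b) = scomp (fsq a) (fsq b);

  fcmp : forall (x y z : ob D) (M : hor x y) (N : hor y z),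
    sq (hcomp (fhor M) (fhor N)) (fhor (hcomp M N));
  fcmp_glob : forall (x y z : ob D) (M : hor x y) (N : hor y z),
    globular (fcmp M N);
  fcmp_inv : forall (x y z : ob D) (M : hor x y) (N : hor y z),
    invertible (fcmp M N);
  fcmp_nat : forall (x y z x' y' z' : ob D) (M : hor x y) (N : hor y z)
    (M' : hor x' y') (N' : hor y' z') (a : sq M M') (b : sq N N')
    (e : rf a = lf b) (e' : rf (fsq a) = lf (fsq b)),
    scomp (hsq (fsq a) (fsq b) e') (fcmp M' N')
    = scomp (fcmp M N) (fsq (hsq a b e));

  funit : forall x : ob D, sq (hunit (fob x)) (fhor (hunit x));
  funit_glob : forall x : ob D, globular (funit x);
  funit_inv : forall x : ob D, invertible (funit x);
  funit_nat : forall (x y : ob D) (f : ver x y),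
    scomp (usq (fver f)) (funit y) = scomp (funit x) (fsq (usq f));

  fcmp_assoc : forall (x y z w : ob D) (M : hor x y) (N : hor y z) (P : hor z w)
    (e1 : rf (fcmp M N) = lf (sid (fhor P)))
    (e2 : rf (sid (fhor M)) = lf (fcmp N P)),
    scomp (hsq (fcmp M N) (sid (fhor P)) e1)
          (scomp (fcmp (hcomp M N) P) (fsq (assoc M N P)))
    = scomp (assoc (fhor M) (fhor N) (fhor P))
            (scomp (hsq (sid (fhor M)) (fcmp N P) e2) (fcmp M (hcomp N P)));
  fcmp_lunit : forall (x y : ob D) (M : hor x y)
    (e : rf (funit x) = lf (sid (fhor M))),
    scomp (hsq (funit x) (sid (fhor M)) e)
          (scomp (fcmp (hunit x) M) (fsq (lunit M)))
    = lunit (fhor M);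
  fcmp_runit : forall (x y : ob D) (M : hor x y)
    (e : rf (sid (fhor M)) = lf (funit y)),
    scomp (hsq (sid (fhor M)) (funit y) e)
          (scomp (fcmp M (hunit y)) (fsq (runit M)))
    = runit (fhor M)
}.

Arguments fob {D C} d. Arguments fver {D C} d {x y}.
Arguments fhor {D C} d {x y}. Arguments fsq {D C} d {x y x' y' M M'}.
Arguments fcmp {D C} d {x y z}. Arguments funit {D C} d.

(** No preservation of cartesian squares is required: it is automatic. *)
Definition StrongFramedFunctor (D C : FramedBicategory) : Type :=
  DoubleFunctor D C.

Definition strict (D C : DoubleCategory) (F : DoubleFunctor D C) : Prop :=
  (forall (x y z : ob D) (M : hor x y) (N : hor y z),
    existT (fun P => sq (hcomp (fhor F M) (fhor F N)) P)
      (fhor F (hcomp M N)) (fcmp F M N)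
    = existT _ (hcomp (fhor F M) (fhor F N)) (sid _)) /\
  (forall x : ob D,
    existT (fun P => sq (hunit (fob F x)) P) (fhor F (hunit x)) (funit F x)
    = existT _ (hunit (fob F x)) (sid _)).

Section Composition.
Variables (E D C : DoubleCategory).
Variables (G : DoubleFunctor E D) (F : DoubleFunctor D C).

Let cob (x : ob E) : ob C := fob F (fob G x).
Let cver (x y : ob E) (f : ver x y) : ver (cob x) (cob y) := fver F (fver G f).
Let chor (x y : ob E) (M : hor x y) : hor (cob x) (cob y) := fhor F (fhor G M).
Let csq (x y x' y' : ob E) (M : hor x y) (M' : hor x' y') (a : sq M M') :
  sq (chor M) (chor M') := fsq F (fsq G a).
Let ccmp (x y z : ob E) (M : hor x y) (N : hor y z) :
  sq (hcomp (chor M) (chor N)) (chor (hcomp M N)) :=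
  scomp (fcmp F (fhor G M) (fhor G N)) (fsq F (fcmp G M N)).
Let cunit (x : ob E) : sq (hunit (cob x)) (chor (hunit x)) :=
  scomp (funit F (fob G x)) (fsq F (funit G x)).

Lemma globular_scomp (X : DoubleCategory) (x y : ob X) (M N P : hor x y)
    (a : sq M N) (b : sq N P) :
  globular a -> globular b -> globular (scomp a b).
Proof.
intros [la ra] [lb rb]; split;
  [rewrite lf_comp, la, lb | rewrite rf_comp, ra, rb]; apply vcomp_idl.
Qed.

Lemma globular_fsq (x y : ob D) (M N : hor x y) (a : sq M N) :
  globular a -> globular (fsq F a).
Proof.
intros [la ra]; split;
  [rewrite lf_fsq, la | rewrite rf_fsq, ra]; apply fver_id.
Qed.

Lemma invertible_scomp (X : DoubleCategory) (x y x' y' x'' y'' : ob X)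
    (M : hor x y) (N : hor x' y') (P : hor x'' y'') (a : sq M N) (b : sq N P) :
  invertible a -> invertible b -> invertible (scomp a b).
Proof.
intros [a' [a1 a2]] [b' [b1 b2]]; exists (scomp b' a'); split.
- rewrite scomp_assoc, <- (scomp_assoc b), b1, scomp_idl; exact a1.
- rewrite scomp_assoc, <- (scomp_assoc a'), a2, scomp_idl; exact b2.
Qed.

Lemma invertible_fsq (x y x' y' : ob D) (M : hor x y) (N : hor x' y')
    (a : sq M N) : invertible a -> invertible (fsq F a).
Proof.
intros [b [b1 b2]]; exists (fsq F b); split;
  rewrite <- fsq_comp; [rewrite b1 | rewrite b2]; apply fsq_id.
Qed.

Lemma ccmp_nat (x y z x' y' z' : ob E) (M : hor x y) (N : hor y z)
    (M' : hor x' y') (N' : hor y' z') (a : sq M M') (b : sq N N')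
    (e : rf a = lf b) (e' : rf (csq a) = lf (csq b)) :
  scomp (hsq (csq a) (csq b) e') (ccmp M' N')
  = scomp (ccmp M N) (csq (hsq a b e)).
Proof.
unfold ccmp, csq, chor, cob in *.
assert (e1 : rf (fsq G a) = lf (fsq G b)) by now rewrite rf_fsq, lf_fsq, e.
rewrite <- scomp_assoc, (fcmp_nat e1 e'), !scomp_assoc, <- !fsq_comp.
now rewrite (fcmp_nat e e1).
Qed.

Lemma cunit_nat (x y : ob E) (f : ver x y) :
  scomp (usq (cver f)) (cunit y) = scomp (cunit x) (csq (usq f)).
Proof.
unfold cunit, csq, cver, chor, cob.
rewrite <- scomp_assoc, funit_nat, !scomp_assoc, <- !fsq_comp.
now rewrite funit_nat.
Qed.

Lemma whisker_r (x y z : ob E) (w : ob D) (P : hor (fob G z) w)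
    (M : hor x y) (N : hor y z)
    (e1 : rf (scomp (fcmp F (fhor G M) (fhor G N)) (fsq F (fcmp G M N))) = lf (sid (fhor F P)))
    (e2 : rf (fcmp F (fhor G M) (fhor G N)) = lf (sid (fhor F P)))
    (e3 : rf (fcmp G M N) = lf (sid P)) :
  scomp (hsq (scomp (fcmp F (fhor G M) (fhor G N)) (fsq F (fcmp G M N))) (sid (fhor F P)) e1) (fcmp F (fhor G (hcomp M N)) P)
  = scomp (hsq (fcmp F (fhor G M) (fhor G N)) (sid (fhor F P)) e2)
      (scomp (fcmp F (hcomp (fhor G M) (fhor G N)) P)
             (fsq F (hsq (fcmp G M N) (sid P) e3))).
Proof.
assert (e4 : rf (fsq F (fcmp G M N)) = lf (fsq F (sid P)))
  by now rewrite rf_fsq, lf_fsq, e3.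
rewrite <- (fcmp_nat e3 e4), <- scomp_assoc.
f_equal.
assert (e5 : rf (scomp (fcmp F (fhor G M) (fhor G N)) (fsq F (fcmp G M N)))
    = lf (scomp (sid (fhor F P)) (fsq F (sid P)))).
{ rewrite fsq_id, scomp_idl; exact e1. }
rewrite <- (hsq_comp e2 e4 e5).
apply hsq_congr; [reflexivity|]. now rewrite fsq_id, scomp_idl.
Qed.

Lemma whisker_l (x y z : ob E) (w : ob D) (P : hor w (fob G x))
    (M : hor x y) (N : hor y z)
    (e1 : rf (sid (fhor F P)) = lf (scomp (fcmp F (fhor G M) (fhor G N)) (fsq F (fcmp G M N))))
    (e2 : rf (sid (fhor F P)) = lf (fcmp F (fhor G M) (fhor G N)))
    (e3 : rf (sid P) = lf (fcmp G M N)) :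
  scomp (hsq (sid (fhor F P)) (scomp (fcmp F (fhor G M) (fhor G N)) (fsq F (fcmp G M N))) e1) (fcmp F P (fhor G (hcomp M N)))
  = scomp (hsq (sid (fhor F P)) (fcmp F (fhor G M) (fhor G N)) e2)
      (scomp (fcmp F P (hcomp (fhor G M) (fhor G N)))
             (fsq F (hsq (sid P) (fcmp G M N) e3))).
Proof.
assert (e4 : rf (fsq F (sid P)) = lf (fsq F (fcmp G M N)))
  by now rewrite rf_fsq, lf_fsq, e3.
rewrite <- (fcmp_nat e3 e4), <- scomp_assoc.
f_equal.
assert (e5 : rf (scomp (sid (fhor F P)) (fsq F (sid P))) = lf (scomp (fcmp F (fhor G M) (fhor G N)) (fsq F (fcmp G M N)))).
{ rewrite fsq_id, scomp_idl; exact e1. }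
rewrite <- (hsq_comp e2 e4 e5).
apply hsq_congr; [|reflexivity]. now rewrite fsq_id, scomp_idl.
Qed.

Lemma ccmp_assoc (x y z w : ob E) (M : hor x y) (N : hor y z) (P : hor z w)
    (e1 : rf (ccmp M N) = lf (sid (chor P)))
    (e2 : rf (sid (chor M)) = lf (ccmp N P)) :
  scomp (hsq (ccmp M N) (sid (chor P)) e1)
        (scomp (ccmp (hcomp M N) P) (csq (assoc M N P)))
  = scomp (assoc (chor M) (chor N) (chor P))
          (scomp (hsq (sid (chor M)) (ccmp N P) e2) (ccmp M (hcomp N P))).
Proof.
assert (d1 : rf (fcmp F (fhor G M) (fhor G N)) = lf (sid (fhor F (fhor G P)))).
{ rewrite lf_id; apply fcmp_glob. }
assert (d2 : rf (fcmp G M N) = lf (sid (fhor G P))).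
{ rewrite lf_id; apply fcmp_glob. }
assert (d3 : rf (sid (fhor F (fhor G M))) = lf (fcmp F (fhor G N) (fhor G P))).
{ rewrite rf_id; symmetry; apply fcmp_glob. }
assert (d4 : rf (sid (fhor G M)) = lf (fcmp G N P)).
{ rewrite rf_id; symmetry; apply fcmp_glob. }
unfold ccmp, csq, chor, cob in *.
rewrite (scomp_assoc (fcmp F (fhor G (hcomp M N)) _)).
rewrite <- (scomp_assoc (hsq _ _ e1)).
rewrite (whisker_r (P := fhor G P) e1 d1 d2).
rewrite <- (scomp_assoc (hsq _ _ e2)).
rewrite (whisker_l (P := fhor G M) e2 d3 d4).
rewrite !scomp_assoc.
rewrite <- !fsq_comp.
rewrite (fcmp_assoc d2 d4).
rewrite !fsq_comp.
pose proof (@fcmp_assoc _ _ F _ _ _ _ (fhor G M) (fhor G N) (fhor G P) d1 d3) as H.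
rewrite <- (scomp_assoc (fcmp F (hcomp (fhor G M) (fhor G N)) (fhor G P))).
rewrite <- (scomp_assoc (hsq _ _ d1)).
etransitivity; [apply (f_equal (fun s => scomp s _)), H|].
now rewrite !scomp_assoc.
Qed.

Lemma ccmp_lunit (x y : ob E) (M : hor x y)
    (e : rf (cunit x) = lf (sid (chor M))) :
  scomp (hsq (cunit x) (sid (chor M)) e)
        (scomp (ccmp (hunit x) M) (csq (lunit M)))
  = lunit (chor M).
Proof.
assert (d1 : rf (funit F (fob G x)) = lf (sid (fhor F (fhor G M)))).
{ rewrite lf_id; apply funit_glob. }
assert (d2 : rf (funit G x) = lf (sid (fhor G M))).
{ rewrite lf_id; apply funit_glob. }
assert (d3 : rf (fsq F (funit G x)) = lf (fsq F (sid (fhor G M))))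
  by now rewrite rf_fsq, lf_fsq, d2.
unfold cunit, ccmp, csq, chor, cob in *.
rewrite <- (fcmp_lunit d1), <- (fcmp_lunit d2).
rewrite !fsq_comp.
rewrite <- (scomp_assoc (fcmp F (hunit (fob G x)) _)).
rewrite <- (fcmp_nat d2 d3), ?scomp_assoc.
rewrite <- (scomp_assoc (hsq _ _ d1)).
assert (e5 : rf (scomp (funit F (fob G x)) (fsq F (funit G x)))
   = lf (scomp (sid (fhor F (fhor G M))) (fsq F (sid (fhor G M))))).
{ rewrite fsq_id, scomp_idl; exact e. }
rewrite <- (hsq_comp d1 d3 e5).
rewrite ?scomp_assoc; f_equal.
apply hsq_congr; [reflexivity|]. now rewrite fsq_id, scomp_idl.
Qed.

Lemma ccmp_runit (x y : ob E) (M : hor x y)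
    (e : rf (sid (chor M)) = lf (cunit y)) :
  scomp (hsq (sid (chor M)) (cunit y) e)
        (scomp (ccmp M (hunit y)) (csq (runit M)))
  = runit (chor M).
Proof.
assert (d1 : rf (sid (fhor F (fhor G M))) = lf (funit F (fob G y))).
{ rewrite rf_id; symmetry; apply funit_glob. }
assert (d2 : rf (sid (fhor G M)) = lf (funit G y)).
{ rewrite rf_id; symmetry; apply funit_glob. }
assert (d3 : rf (fsq F (sid (fhor G M))) = lf (fsq F (funit G y)))
  by now rewrite rf_fsq, lf_fsq, d2.
unfold cunit, ccmp, csq, chor, cob in *.
rewrite <- (fcmp_runit d1), <- (fcmp_runit d2).
rewrite !fsq_comp.
rewrite <- (scomp_assoc (fcmp F _ (hunit (fob G y)))).
rewrite <- (fcmp_nat d2 d3), ?scomp_assoc.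
rewrite <- (scomp_assoc (hsq _ _ d1)).
assert (e5 : rf (scomp (sid (fhor F (fhor G M))) (fsq F (sid (fhor G M))))
   = lf (scomp (funit F (fob G y)) (fsq F (funit G y)))).
{ rewrite fsq_id, scomp_idl; exact e. }
rewrite <- (hsq_comp d1 d3 e5).
rewrite ?scomp_assoc; f_equal.
apply hsq_congr; [|reflexivity]. now rewrite fsq_id, scomp_idl.
Qed.

(** [G] followed by [F]. *)
Definition compose_functor : DoubleFunctor E C.
Proof.
refine {| fob := cob; fver := cver; fhor := chor; fsq := csq;
          fcmp := ccmp; funit := cunit |}.
- intro x; unfold cver; now rewrite !fver_id.
- intros; unfold cver; now rewrite !fver_comp.
- intros; unfold csq, cver, chor, cob; now rewrite !lf_fsq.
- intros; unfold csq, cver, chor, cob; now rewrite !rf_fsq.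
- intros; unfold csq, chor, cob; now rewrite !fsq_id.
- intros; unfold csq, chor, cob; now rewrite !fsq_comp.
- intros; apply globular_scomp; [|apply globular_fsq]; apply fcmp_glob.
- intros; apply invertible_scomp; [|apply invertible_fsq]; apply fcmp_inv.
- exact ccmp_nat.
- intros; apply globular_scomp; [|apply globular_fsq]; apply funit_glob.
- intros; apply invertible_scomp; [|apply invertible_fsq]; apply funit_inv.
- exact cunit_nat.
- exact ccmp_assoc.
- exact ccmp_lunit.
- exact ccmp_runit.
Defined.

End Composition.

(** Predicates on the four sorts of cells closed under all the structure,
    including the coherence squares and their inverses; not assumed full. *)
Record SubDouble (C : DoubleCategory) : Type := {
  sob : ob C -> Prop;
  sver : forall x y : ob C, ver x y -> Prop;
  shor : forall x y : ob C, hor x y -> Prop;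
  ssq : forall (x y x' y' : ob C) (M : hor x y) (M' : hor x' y'),
    sq M M' -> Prop;

  sver_ob : forall (x y : ob C) (f : ver x y), sver f -> sob x /\ sob y;
  shor_ob : forall (x y : ob C) (M : hor x y), shor M -> sob x /\ sob y;
  ssq_hor : forall (x y x' y' : ob C) (M : hor x y) (M' : hor x' y')
    (a : sq M M'), ssq a -> shor M /\ shor M';
  ssq_lf : forall (x y x' y' : ob C) (M : hor x y) (M' : hor x' y')
    (a : sq M M'), ssq a -> sver (lf a);
  ssq_rf : forall (x y x' y' : ob C) (M : hor x y) (M' : hor x' y')
    (a : sq M M'), ssq a -> sver (rf a);

  sver_id : forall x : ob C, sob x -> sver (vid x);
  sver_comp : forall (x y z : ob C) (f : ver x y) (g : ver y z),
    sver f -> sver g -> sver (vcomp f g);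
  ssq_id : forall (x y : ob C) (M : hor x y), shor M -> ssq (sid M);
  ssq_comp : forall (x y x' y' x'' y'' : ob C)
    (M : hor x y) (M' : hor x' y') (M'' : hor x'' y'')
    (a : sq M M') (b : sq M' M''), ssq a -> ssq b -> ssq (scomp a b);
  shor_unit : forall x : ob C, sob x -> shor (hunit x);
  ssq_usq : forall (x y : ob C) (f : ver x y), sver f -> ssq (usq f);
  shor_comp : forall (x y z : ob C) (M : hor x y) (N : hor y z),
    shor M -> shor N -> shor (hcomp M N);
  ssq_hsq : forall (x y z x' y' z' : ob C) (M : hor x y) (N : hor y z)
    (M' : hor x' y') (N' : hor y' z') (a : sq M M') (b : sq N N')
    (e : rf a = lf b), ssq a -> ssq b -> ssq (hsq a b e);

  ssq_assoc : forall (x y z w : ob C) (M : hor x y) (N : hor y z) (P : hor z w),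
    shor M -> shor N -> shor P -> ssq (assoc M N P);
  ssq_assoc_inv :
    forall (x y z w : ob C) (M : hor x y) (N : hor y z) (P : hor z w)
    (b : sq (hcomp M (hcomp N P)) (hcomp (hcomp M N) P)),
    shor M -> shor N -> shor P -> inverse_squares (assoc M N P) b -> ssq b;
  ssq_lunit : forall (x y : ob C) (M : hor x y), shor M -> ssq (lunit M);
  ssq_lunit_inv : forall (x y : ob C) (M : hor x y)
    (b : sq M (hcomp (hunit x) M)),
    shor M -> inverse_squares (lunit M) b -> ssq b;
  ssq_runit : forall (x y : ob C) (M : hor x y), shor M -> ssq (runit M);
  ssq_runit_inv : forall (x y : ob C) (M : hor x y)
    (b : sq M (hcomp M (hunit y))),
    shor M -> inverse_squares (runit M) b -> ssq b
}.

Arguments sob {C} s. Arguments sver {C} s {x y}.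
Arguments shor {C} s {x y}. Arguments ssq {C} s {x y x' y' M M'}.

Section SubDoubleCategory.
Variables (C : DoubleCategory) (S : SubDouble C).

Let Ob : Type := sub (sob S).
Let Ver (x y : Ob) : Type := sub (@sver C S (val x) (val y)).
Let Hor (x y : Ob) : Type := sub (@shor C S (val x) (val y)).
Let Sq (x y x' y' : Ob) (M : Hor x y) (M' : Hor x' y') : Type :=
  sub (@ssq C S _ _ _ _ (val M) (val M')).

Definition sub_double : DoubleCategory.
Proof.
refine {|
  ob := Ob;
  ver := Ver;
  vid := fun x => mk (vid (val x)) (sver_id (prf x));
  vcomp := fun x y z f g =>
    mk (vcomp (val f) (val g)) (sver_comp (prf f) (prf g));
  hor := Hor;
  sq := Sq;
  sid := fun x y M => mk (sid (val M)) (ssq_id (prf M));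
  scomp := fun _ _ _ _ _ _ _ _ _ a b =>
    mk (scomp (val a) (val b)) (ssq_comp (prf a) (prf b));
  lf := fun _ _ _ _ _ _ a => mk (lf (val a)) (ssq_lf (prf a));
  rf := fun _ _ _ _ _ _ a => mk (rf (val a)) (ssq_rf (prf a));
  hunit := fun x => mk (hunit (val x)) (shor_unit (prf x));
  usq := fun x y f => mk (usq (val f)) (ssq_usq (prf f));
  hcomp := fun x y z M N =>
    mk (hcomp (val M) (val N)) (shor_comp (prf M) (prf N));
  hsq := fun _ _ _ _ _ _ _ _ _ _ a b e =>
    mk (hsq (val a) (val b) (f_equal val e)) (ssq_hsq _ (prf a) (prf b));
  assoc := fun _ _ _ _ M N P =>
    mk (assoc (val M) (val N) (val P)) (ssq_assoc (prf M) (prf N) (prf P));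
  lunit := fun _ _ M => mk (lunit (val M)) (ssq_lunit (prf M));
  runit := fun _ _ M => mk (runit (val M)) (ssq_runit (prf M))
|}; intros; try (apply sub_eq; simpl).
- apply vcomp_idl.
- apply vcomp_idr.
- apply vcomp_assoc.
- apply scomp_idl.
- apply scomp_idr.
- apply scomp_assoc.
- apply lf_id.
- apply rf_id.
- apply lf_comp.
- apply rf_comp.
- apply lf_usq.
- apply rf_usq.
- apply usq_id.
- apply usq_comp.
- apply lf_hsq.
- apply rf_hsq.
- apply hsq_id.
- apply hsq_comp.
- apply lf_assoc.
- apply rf_assoc.
- destruct (assoc_inv (val M) (val N) (val P)) as [b [b1 b2]].
  exists (mk b (ssq_assoc_inv (prf M) (prf N) (prf P) (conj b1 b2))).
  split; apply sub_eq; assumption.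
- apply assoc_nat.
- apply lf_lunit.
- apply rf_lunit.
- destruct (lunit_inv (val M)) as [b [b1 b2]].
  exists (mk b (ssq_lunit_inv (prf M) (conj b1 b2))).
  split; apply sub_eq; assumption.
- apply lunit_nat.
- apply lf_runit.
- apply rf_runit.
- destruct (runit_inv (val M)) as [b [b1 b2]].
  exists (mk b (ssq_runit_inv (prf M) (conj b1 b2))).
  split; apply sub_eq; assumption.
- apply runit_nat.
- apply pentagon.
- apply triangle.
Defined.

Lemma sid_inverse (x y : ob C) (M : hor x y) : inverse_squares (sid M) (sid M).
Proof. split; apply scomp_idl. Qed.

Definition sub_inclusion : DoubleFunctor sub_double C.
Proof.
refine {|
  fob := fun x : ob sub_double => val x;
  fver := fun x y (f : @ver sub_double x y) => val f;
  fhor := fun x y (M : @hor sub_double x y) => val M;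
  fsq := fun _ _ _ _ _ _ (a : @sq sub_double _ _ _ _ _ _) => val a;
  fcmp := fun x y z (M : @hor sub_double x y) (N : @hor sub_double y z) =>
    sid (hcomp (val M) (val N));
  funit := fun x : ob sub_double => sid (hunit (val x))
|}; intros; simpl; try reflexivity.
- split; [apply lf_id | apply rf_id].
- exists (sid (hcomp (val M) (val N))); apply sid_inverse.
- rewrite scomp_idl, scomp_idr; now apply hsq_congr.
- split; [apply lf_id | apply rf_id].
- exists (sid (hunit (val x))); apply sid_inverse.
- now rewrite scomp_idl, scomp_idr.
- rewrite !hsq_id, !scomp_idl, scomp_idr; reflexivity.
- rewrite !hsq_id, !scomp_idl; reflexivity.
- rewrite !hsq_id, !scomp_idl; reflexivity.
Defined.

Lemma sub_inclusion_strict : strict sub_inclusion.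
Proof. split; reflexivity. Qed.

End SubDoubleCategory.

(** The cleavage of the sub-double category is not required to be that of [C]. *)
Definition sub_framed (C : DoubleCategory) (S : SubDouble C) : Prop :=
  inhabited (Framing (sub_double S)).

(** [T], a sub-double category of the sub-double category [W] of [C], has the
    same cells as the sub-double category [S] of [C]. *)
Record same_cells (C : DoubleCategory) (W : SubDouble C)
    (T : SubDouble (sub_double W)) (S : SubDouble C) : Prop := {
  same_ob : forall x : ob C,
    sob S x <-> exists p : sob W x, sob T (mk x p);
  same_ver : forall (x y : ob C) (f : ver x y),
    sver S f <->
    exists (px : sob W x) (py : sob W y) (pf : sver W f),
      @sver _ T (mk x px) (mk y py) (mk f pf);
  same_hor : forall (x y : ob C) (M : hor x y),
    shor S M <->
    exists (px : sob W x) (py : sob W y) (pM : shor W M),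
      @shor _ T (mk x px) (mk y py) (mk M pM);
  same_sq : forall (x y x' y' : ob C) (M : hor x y) (M' : hor x' y')
    (a : sq M M'),
    ssq S a <->
    exists (px : sob W x) (py : sob W y) (px' : sob W x') (py' : sob W y')
      (pM : shor W M) (pM' : shor W M') (pa : ssq W a),
      @ssq _ T (mk x px) (mk y py) (mk x' px') (mk y' py')
        (mk M pM) (mk M' pM') (mk a pa)
}.

Definition sub_framed_of (C : DoubleCategory) (W S : SubDouble C) : Prop :=
  exists T : SubDouble (sub_double W), sub_framed T /\ same_cells T S.

(** Automatic when [S] is full on squares; for a general [S], a globular square
    of [S] may be invertible in [C] without being invertible in [S], and then a
    square of [S] that is cartesian in [C] may fail to be cartesian in [S]. *)
Definition closed_under_globular_inverses (C : DoubleCategory)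
    (S : SubDouble C) : Prop :=
  forall (x y : ob C) (M N : hor x y) (a : sq M N) (b : sq N M),
    globular a -> inverse_squares a b -> ssq S a -> ssq S b.

Section Spanned.
Variables (C : FramedBicategory) (W : forall x y : ob C, ver x y -> Prop).
Hypothesis W_id : forall x : ob C, W (vid x).
Hypothesis W_comp : forall (x y z : ob C) (f : ver x y) (g : ver y z),
  W f -> W g -> W (vcomp f g).

Lemma inverse_frames (x y : ob C) (M N : hor x y) (a : sq M N) (b : sq N M) :
  globular a -> inverse_squares a b -> W (lf b) /\ W (rf b).
Proof.
intros [la ra] [e _]; split.
- pose proof (f_equal lf e) as h.
  rewrite lf_comp, la, vcomp_idl, lf_id in h; rewrite h; apply W_id.
- pose proof (f_equal rf e) as h.
  rewrite rf_comp, ra, vcomp_idl, rf_id in h; rewrite h; apply W_id.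
Qed.

Definition spanned : SubDouble C.
Proof.
refine {|
  sob := fun _ => True;
  sver := W;
  shor := fun _ _ _ => True;
  ssq := fun _ _ _ _ _ _ a => W (lf a) /\ W (rf a)
|}; intros; try (split; exact I); try exact I; try tauto.
- apply W_id.
- now apply W_comp.
- rewrite lf_id, rf_id; split; apply W_id.
- rewrite lf_comp, rf_comp; split; apply W_comp; tauto.
- now rewrite lf_usq, rf_usq.
- rewrite lf_hsq, rf_hsq; tauto.
- rewrite lf_assoc, rf_assoc; split; apply W_id.
- apply (inverse_frames (conj (lf_assoc M N P) (rf_assoc M N P)) H2).
- rewrite lf_lunit, rf_lunit; split; apply W_id.
- apply (inverse_frames (conj (lf_lunit M) (rf_lunit M)) H0).
- rewrite lf_runit, rf_runit; split; apply W_id.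
- apply (inverse_frames (conj (lf_runit M) (rf_runit M)) H0).
Defined.

Lemma spanned_cartesian (x y z w : ob (sub_double spanned))
    (M : hor x y) (N : hor z w) (a : sq M N) :
  cartesian (val a) -> cartesian a.
Proof.
intros ca x' y' P b u v eu ev.
destruct (ca _ _ (val P) (val b) (val u) (val v)
           (f_equal val eu) (f_equal val ev)) as [c [[lc [rc ec]] uc]].
assert (pc : W (lf c) /\ W (rf c)).
{ rewrite lc, rc; split; [exact (prf u) | exact (prf v)]. }
exists (mk c pc : sq P M); split.
- split; [|split]; apply sub_eq; assumption.
- intros d [ld [rd ed]]; apply sub_eq; simpl; apply uc.
  now rewrite <- ld, <- rd, <- ed.
Qed.

Lemma spanned_opcartesian (x y z w : ob (sub_double spanned))
    (M : hor x y) (N : hor z w) (a : sq M N) :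
  opcartesian (val a) -> opcartesian a.
Proof.
intros ca z' w' P b u v eu ev.
destruct (ca _ _ (val P) (val b) (val u) (val v)
           (f_equal val eu) (f_equal val ev)) as [c [[lc [rc ec]] uc]].
assert (pc : W (lf c) /\ W (rf c)).
{ rewrite lc, rc; split; [exact (prf u) | exact (prf v)]. }
exists (mk c pc : sq N P); split.
- split; [|split]; apply sub_eq; assumption.
- intros d [ld [rd ed]]; apply sub_eq; simpl; apply uc.
  now rewrite <- ld, <- rd, <- ed.
Qed.

Lemma spanned_normal (z w : ob C) (N : hor z w)
    (s t : {M : hor z w & sq M N})
    (ps : W (lf (projT2 s)) /\ W (rf (projT2 s)))
    (pt : W (lf (projT2 t)) /\ W (rf (projT2 t))) :
  s = t ->
  existT (fun M : sub (fun _ : hor z w => True) =>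
      sub (fun a : sq (val M) N => W (lf a) /\ W (rf a)))
    (mk (projT1 s) I) (mk (projT2 s) ps)
  = existT (fun M : sub (fun _ : hor z w => True) =>
      sub (fun a : sq (val M) N => W (lf a) /\ W (rf a)))
    (mk (projT1 t) I) (mk (projT2 t) pt).
Proof.
intro e; subst t; now rewrite (proof_irrelevance _ ps pt).
Qed.

Definition spanned_framing : Framing (sub_double spanned).
Proof.
pose (R := framing C).
assert (p : forall (x y z w : ob (sub_double spanned)) (f : ver x z)
  (g : ver y w) (N : hor z w),
  W (lf (restr_sq R (val f) (val g) (val N))) /\
  W (rf (restr_sq R (val f) (val g) (val N)))).
{ intros; rewrite lf_restr, rf_restr; split; [exact (prf f) | exact (prf g)]. }
refine {|
  restr := fun (x y z w : ob (sub_double spanned)) (f : ver x z) (g : ver y w)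
    (N : hor z w) => mk (restr R (val f) (val g) (val N)) I : hor x y;
  restr_sq := fun (x y z w : ob (sub_double spanned)) (f : ver x z)
    (g : ver y w) (N : hor z w) =>
    mk (restr_sq R (val f) (val g) (val N)) (p x y z w f g N)
|}.
- intros; apply sub_eq; apply lf_restr.
- intros; apply sub_eq; apply rf_restr.
- intros; apply spanned_cartesian; apply restr_cartesian.
- intros [z []] [w []] [N []].
  exact (spanned_normal _ _ (restr_normal R N)).
- intros x y z w f g M.
  destruct (opcartesian_lift R (val f) (val g) (val M))
    as [N [a [la [ra ca]]]].
  assert (pa : W (lf a) /\ W (rf a)).
  { rewrite la, ra; split; [exact (prf f) | exact (prf g)]. }
  exists (mk N I : hor z w), (mk a pa : sq M (mk N I : hor z w)).
  split; [|split]; [apply sub_eq; exact la | apply sub_eq; exact ra |].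
  now apply spanned_opcartesian.
Defined.

End Spanned.

Section Classes.
Variable C : DoubleCategory.

Lemma ff_ver_id (x : ob C) : ff_ver (vid x).
Proof.
intros x' y' P b u v eu ev; rewrite usq_id in *.
rewrite lf_id, vcomp_idr in eu; rewrite rf_id, vcomp_idr in ev.
exists b; split; [now rewrite scomp_idr|].
intros c [_ [_ ec]]; now rewrite scomp_idr in ec.
Qed.

Lemma ad_ver_id (x : ob C) : ad_ver (vid x).
Proof.
intros x' y' P b u v eu ev; rewrite usq_id in *.
rewrite lf_id, vcomp_idl in eu; rewrite rf_id, vcomp_idl in ev.
exists b; split; [now rewrite scomp_idl|].
intros c [_ [_ ec]]; now rewrite scomp_idl in ec.
Qed.

Lemma cartesian_scomp (x y x' y' x'' y'' : ob C) (M : hor x y) (N : hor x' y')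
    (P : hor x'' y'') (a : sq M N) (b : sq N P) :
  cartesian a -> cartesian b -> cartesian (scomp a b).
Proof.
intros ca cb z w Q c u v eu ev.
rewrite lf_comp, <- vcomp_assoc in eu; rewrite rf_comp, <- vcomp_assoc in ev.
destruct (cb _ _ Q c _ _ eu ev) as [d [[ld [rd ed]] ud]].
destruct (ca _ _ Q d _ _ ld rd) as [k [[lk [rk ek]] uk]].
exists k; split.
- repeat split; auto. now rewrite <- scomp_assoc, ek.
- intros k' [lk' [rk' ek']]; apply uk; repeat split; auto.
  symmetry; apply ud; rewrite lf_comp, rf_comp, lk', rk'.
  repeat split; auto. now rewrite scomp_assoc.
Qed.

Lemma opcartesian_scomp (x y x' y' x'' y'' : ob C) (M : hor x y)
    (N : hor x' y') (P : hor x'' y'') (a : sq M N) (b : sq N P) :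
  opcartesian a -> opcartesian b -> opcartesian (scomp a b).
Proof.
intros ca cb z w Q c u v eu ev.
rewrite lf_comp, vcomp_assoc in eu; rewrite rf_comp, vcomp_assoc in ev.
destruct (ca _ _ Q c _ _ eu ev) as [d [[ld [rd ed]] ud]].
destruct (cb _ _ Q d _ _ ld rd) as [k [[lk [rk ek]] uk]].
exists k; split.
- repeat split; auto. now rewrite scomp_assoc, ek.
- intros k' [lk' [rk' ek']]; apply uk; repeat split; auto.
  symmetry; apply ud; rewrite lf_comp, rf_comp, lk', rk'.
  repeat split; auto. now rewrite <- scomp_assoc.
Qed.

Lemma ff_ver_comp (x y z : ob C) (f : ver x y) (g : ver y z) :
  ff_ver f -> ff_ver g -> ff_ver (vcomp f g).
Proof. intros; unfold ff_ver; rewrite usq_comp; now apply cartesian_scomp. Qed.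

Lemma ad_ver_comp (x y z : ob C) (f : ver x y) (g : ver y z) :
  ad_ver f -> ad_ver g -> ad_ver (vcomp f g).
Proof. intros; unfold ad_ver; rewrite usq_comp; now apply opcartesian_scomp. Qed.

End Classes.

Definition tilde_sub (C : FramedBicategory) : SubDouble C :=
  spanned (@ff_ver_id C) (@ff_ver_comp C).

Definition hat_sub (C : FramedBicategory) : SubDouble C :=
  spanned (@ad_ver_id C) (@ad_ver_comp C).

Definition tilde (C : FramedBicategory) : FramedBicategory :=
  {| dcat := sub_double (tilde_sub C);
     framing := spanned_framing (@ff_ver_id C) (@ff_ver_comp C) |}.

Definition hat (C : FramedBicategory) : FramedBicategory :=
  {| dcat := sub_double (hat_sub C);
     framing := spanned_framing (@ad_ver_id C) (@ad_ver_comp C) |}.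

Lemma tilde_fully_faithful (C : FramedBicategory) : fully_faithful (tilde C).
Proof. intros x y f; apply spanned_cartesian; exact (prf f). Qed.

Lemma hat_absolutely_dense (C : FramedBicategory) : absolutely_dense (hat C).
Proof. intros x y f; apply spanned_opcartesian; exact (prf f). Qed.

Definition tilde_inclusion (C : FramedBicategory) :
  StrongFramedFunctor (tilde C) C := sub_inclusion (tilde_sub C).

Definition hat_inclusion (C : FramedBicategory) :
  StrongFramedFunctor (hat C) C := sub_inclusion (hat_sub C).

(* Main.v *)
From Stdlib Require Import ProofIrrelevance FunctionalExtensionality IndefiniteDescription.
Require Import Defs.

Set Implicit Arguments.
Unset Strict Implicit.
Unset Printing Implicit Defensive.

(** The inclusion of [tilde C] in [C] is full on squares over the fully faithful
    vertical morphisms, so [F : D -> C] factors through it, and then uniquely,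
    as soon as [F] sends every vertical morphism to a fully faithful one.  All
    the content is therefore that functors preserve fully faithful vertical
    morphisms ([ff_ver_fver]) and, for the converse about sub-framed
    bicategories, that some reflect them ([ff_ver_reflect]).

    Preservation holds because, in the presence of restrictions, being cartesian
    is an equational property.  Let [s : M -> N] have frames [f] and [g].
    Restricting units gives a companion [f_!] and a conjoint [g^*], and [s] is
    cartesian exactly when [M] is [f_! N g^*], in the sense that there is a
    globular square [f_! N g^* -> M] compatible with [s] ([fold_s]) and
    retracting the square [1 M 1 -> f_! N g^*] that [s] induces, up to the
    unit constraints ([unfold_fold]).  Such data, a
    [restriction_data s], exist for a cartesian [s]
    ([cartesian_restriction_data]), are carried along by a double functor
    ([restriction_data_fsq]), and force [s] to be cartesian in any double
    category: a square [b : P -> N] over [u f] and [v g] is lifted by widening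
    it to [1 P 1 -> f_! N g^*] and folding ([restriction_data_cartesian]).
    Hence double functors out of a double category with restrictions
    preserve cartesian squares ([cartesian_fsq]), in particular the unit squares
    of fully faithful morphisms.

    For reflection, restrict the unit of [y] along [f : x -> y] in [D], and
    compare: [usq f] is a globular square [c] followed by the restriction.  If
    [fver F f] is fully faithful, the images of both [usq f] and the restriction
    are cartesian with the same frames, so the image of [c] is invertible; when
    [F] reflects this, [c] is invertible and [f] is fully faithful.  For the
    inclusion of a sub-double category, reflecting invertibility of globular
    squares follows from closure under their inverses.

    The absolutely dense half is the same argument in the vertical opposites
    [vop D] and [vop C], where opcartesian squares become cartesian. *)

(** * Horizontal composites and globular squares *)

Section Frames.
Context {C : DoubleCategory}.

Lemma frames_scomp (x y z x' y' z' x'' y'' z'' : ob C)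
    (M : hor x y) (N : hor y z) (M' : hor x' y') (N' : hor y' z')
    (M'' : hor x'' y'') (N'' : hor y'' z'')
    (a : sq M M') (b : sq N N') (a' : sq M' M'') (b' : sq N' N'') :
  rf a = lf b -> rf a' = lf b' -> rf (scomp a a') = lf (scomp b b').
Proof. intros e e'; now rewrite rf_comp, lf_comp, e, e'. Qed.

Lemma scomp_hsq (x y z x' y' z' x'' y'' z'' : ob C)
    (M : hor x y) (N : hor y z) (M' : hor x' y') (N' : hor y' z')
    (M'' : hor x'' y'') (N'' : hor y'' z'')
    (a : sq M M') (b : sq N N') (a' : sq M' M'') (b' : sq N' N'')
    (e : rf a = lf b) (e' : rf a' = lf b') :
  scomp (hsq a b e) (hsq a' b' e')
  = hsq (scomp a a') (scomp b b') (frames_scomp e e').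
Proof. symmetry; apply hsq_comp. Qed.

(** [lunit_nat] with the left frame named, as it usually appears only up to an
    equation. *)
Lemma hsq_usq_lunit (x y x' y' : ob C) (M : hor x y) (M' : hor x' y')
    (f : ver x x') (a : sq M M') (e : rf (usq f) = lf a) :
  scomp (hsq (usq f) a e) (lunit M') = scomp (lunit M) a.
Proof.
assert (f = lf a) by now rewrite <- e, rf_usq.
subst f; apply lunit_nat.
Qed.

Lemma hsq_usq_runit (x y x' y' : ob C) (M : hor x y) (M' : hor x' y')
    (g : ver y y') (a : sq M M') (e : rf a = lf (usq g)) :
  scomp (hsq a (usq g) e) (runit M') = scomp (runit M) a.
Proof.
assert (g = rf a) by now rewrite e, lf_usq.
subst g; apply runit_nat.
Qed.

Lemma globular_inverse (x y : ob C) (M N : hor x y) (a : sq M N) (b : sq N M) :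
  inverse_squares a b -> globular a -> globular b.
Proof.
intros [ab _] [la ra]; split.
- rewrite <- (lf_id M), <- ab, lf_comp, la; symmetry; apply vcomp_idl.
- rewrite <- (rf_id M), <- ab, rf_comp, ra; symmetry; apply vcomp_idl.
Qed.

Lemma inverse_squares_sym (x y x' y' : ob C) (M : hor x y) (N : hor x' y')
    (a : sq M N) (b : sq N M) : inverse_squares a b -> inverse_squares b a.
Proof. now intros [ab ba]. Qed.

End Frames.

(** * Equational witnesses of cartesian squares *)

Definition has_restrictions (D : DoubleCategory) : Prop :=
  forall (x y z w : ob D) (f : ver x z) (g : ver y w) (N : hor z w),
  exists (M : hor x y) (a : sq M N), lf a = f /\ rf a = g /\ cartesian a.

(** A presentation of [M] as [f_! N g^*], for [f] and [g] the frames of [s]: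
    [eta] and [phi] are the structure squares of the companion [f_!], [kappa] and
    [rho] those of the conjoint [g^*], and [fold_sq] is the comparison.  The
    equations say that folding is compatible with the projections to [N], and
    that it retracts the widening [1 M 1 -> f_! N g^*] induced by [s].  They
    involve [s] and finitely many squares with no universal quantification over
    squares, which is what makes them stable under functors. *)
Record restriction_data (C : DoubleCategory) (x y z w : ob C)
    (M : hor x y) (N : hor z w) (s : sq M N) : Type := {
  companion : hor x z;
  conjoint : hor w y;
  eta : sq (hunit x) companion;
  phi : sq companion (hunit z);
  kappa : sq (hunit y) conjoint;
  rho : sq conjoint (hunit w);
  lf_eta : lf eta = vid x;
  rf_eta : rf eta = lf s;
  lf_phi : lf phi = lf s;
  rf_phi : rf phi = vid z;
  lf_kappa : lf kappa = rf s;
  rf_kappa : rf kappa = vid y;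
  lf_rho : lf rho = vid w;
  rf_rho : rf rho = rf s;
  eta_phi : scomp eta phi = usq (lf s);
  kappa_rho : scomp kappa rho = usq (rf s);
  fold_sq : sq (hcomp companion (hcomp N conjoint)) M;
  lf_fold : lf fold_sq = vid x;
  rf_fold : rf fold_sq = vid y;
  fold_s : forall (e1 : rf (sid N) = lf rho)
    (e2 : rf phi = lf (scomp (hsq (sid N) rho e1) (runit N))),
    scomp fold_sq s
    = scomp (hsq phi (scomp (hsq (sid N) rho e1) (runit N)) e2) (lunit N);
  unfold_fold : forall (e1 : rf s = lf kappa)
    (e2 : rf eta = lf (hsq s kappa e1))
    (e3 : rf (sid (hunit x)) = lf (runit M)),
    scomp (hsq eta (hsq s kappa e1) e2) fold_sq
    = scomp (hsq (sid (hunit x)) (runit M) e3) (lunit M)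
}.

(** The lift of [b : P -> N] is [P = 1 P 1 -> f_! N g^* -> M].  Composing it with
    [s] contracts [eta phi] and [kappa rho] to unit squares, which the unit
    constraints absorb, leaving [b].  Conversely, when [b] is [d] followed by
    [s], the widening of [b] is that of [d] followed by that of [s], and
    [unfold_fold] returns [d]. *)
Lemma restriction_data_cartesian (C : DoubleCategory) (x y z w : ob C)
    (M : hor x y) (N : hor z w) (s : sq M N) :
  restriction_data s -> cartesian s.
Proof.
intros W x' y' P b u v eu ev.
destruct (lunit_inv P) as [li [_ li_l]].
destruct (runit_inv P) as [ri [_ ri_r]].
assert (lf_ri : lf ri = vid x').
{ pose proof (f_equal lf ri_r) as h.
  now rewrite lf_comp, lf_runit, vcomp_idr, lf_id in h. }
assert (rf_ri : rf ri = vid y').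
{ pose proof (f_equal rf ri_r) as h.
  now rewrite rf_comp, rf_runit, vcomp_idr, rf_id in h. }
assert (lf_li : lf li = vid x').
{ pose proof (f_equal lf li_l) as h.
  now rewrite lf_comp, lf_lunit, vcomp_idr, lf_id in h. }
assert (rf_li : rf li = vid y').
{ pose proof (f_equal rf li_l) as h.
  now rewrite rf_comp, rf_lunit, vcomp_idr, rf_id in h. }
assert (e1 : rf b = lf (scomp (usq v) (kappa W)))
  by now rewrite ev, lf_comp, lf_usq, lf_kappa.
assert (e2 : rf (scomp (usq u) (eta W))
             = lf (scomp ri (hsq b (scomp (usq v) (kappa W)) e1)))
  by now rewrite !rf_comp, lf_comp, rf_usq, rf_eta, lf_hsq, lf_ri, vcomp_idl.
assert (d1 : rf (sid N) = lf (rho W)) by now rewrite rf_id, lf_rho.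
assert (d2 : rf (phi W) = lf (scomp (hsq (sid N) (rho W) d1) (runit N)))
  by now rewrite rf_phi, lf_comp, lf_hsq, lf_id, lf_runit, vcomp_idl.
assert (d3 : rf s = lf (kappa W)) by now rewrite lf_kappa.
assert (d4 : rf (eta W) = lf (hsq s (kappa W) d3)) by now rewrite rf_eta, lf_hsq.
assert (d5 : rf (sid (hunit x)) = lf (runit M)) by now rewrite rf_id, lf_runit.
(* The lift: widen by the unit constraints, map to [f_! N g^*], fold. *)
exists (scomp li (scomp (hsq _ _ e2) (fold_sq W))); split; [split; [|split]|].
- rewrite !lf_comp, lf_hsq, lf_comp, lf_usq, lf_eta, lf_fold, lf_li.
  now rewrite vcomp_idl, !vcomp_idr.
- rewrite !rf_comp, rf_hsq, !rf_comp, rf_hsq, rf_comp, rf_usq, rf_kappa, rf_fold.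
  now rewrite rf_li, rf_ri, !vcomp_idl, !vcomp_idr.
- assert (right : scomp (scomp ri (hsq b (scomp (usq v) (kappa W)) e1))
                    (scomp (hsq (sid N) (rho W) d1) (runit N)) = b).
  { assert (k : scomp (scomp (usq v) (kappa W)) (rho W) = usq (vcomp v (rf s)))
      by now rewrite scomp_assoc, kappa_rho, usq_comp.
    rewrite scomp_assoc, <- (scomp_assoc (hsq b _ e1)), scomp_hsq.
    rewrite (hsq_congr _ (eq_trans ev (eq_sym (lf_usq _))) (scomp_idr b) k).
    now rewrite hsq_usq_runit, <- scomp_assoc, ri_r, scomp_idl. }
  assert (left : scomp (scomp (usq u) (eta W)) (phi W) = usq (lf b))
    by now rewrite scomp_assoc, eta_phi, eu, usq_comp.
  rewrite !scomp_assoc, (fold_s d2), <- (scomp_assoc (hsq _ _ e2)), scomp_hsq.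
  rewrite (hsq_congr _ (rf_usq _) left right).
  now rewrite hsq_usq_lunit, <- scomp_assoc, li_l, scomp_idl.
- intros d [ld [rd ed]].
  assert (t1 : rf d = lf (usq v)) by now rewrite lf_usq.
  assert (t2 : rf (usq u) = lf (scomp ri (hsq d (usq v) t1)))
    by now rewrite rf_usq, lf_comp, lf_ri, lf_hsq, vcomp_idl.
  assert (t3 : rf (usq u) = lf d) by now rewrite rf_usq.
  assert (split_right : scomp ri (hsq b (scomp (usq v) (kappa W)) e1)
    = scomp (scomp ri (hsq d (usq v) t1)) (hsq s (kappa W) d3)).
  { rewrite scomp_assoc, scomp_hsq; f_equal; apply hsq_congr; auto. }
  rewrite (hsq_congr _ (frames_scomp t2 d4) eq_refl split_right).
  rewrite <- scomp_hsq, !scomp_assoc, (unfold_fold d4 d5).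
  rewrite <- (scomp_assoc (hsq _ _ t2)), scomp_hsq.
  assert (r : scomp (scomp ri (hsq d (usq v) t1)) (runit M) = d)
    by now rewrite scomp_assoc, hsq_usq_runit, <- scomp_assoc, ri_r, scomp_idl.
  rewrite (hsq_congr _ t3 (scomp_idr _) r).
  now rewrite hsq_usq_lunit, <- scomp_assoc, li_l, scomp_idl.
Qed.

(** All the squares come from universal properties: [phi] and [rho] are
    restrictions of units, [eta] and [kappa] factor unit squares through them,
    and [fold_sq] factors the projection [f_! N g^* -> N] through [s].  The last
    equation is checked after composing with [s], which is monic for squares
    with given frames. *)
Lemma cartesian_restriction_data (D : DoubleCategory) (x y z w : ob D)
    (M : hor x y) (N : hor z w) (s : sq M N) :
  has_restrictions D -> cartesian s -> inhabited (restriction_data s).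
Proof.
intros R cs.
destruct (R _ _ _ _ (lf s) (vid z) (hunit z)) as [B [ph [lph [rph cph]]]].
destruct (R _ _ _ _ (vid w) (rf s) (hunit w)) as [K [rh [lrh [rrh crh]]]].
destruct (cph _ _ _ (usq (lf s)) (vid x) (lf s)) as [et [[let_ [ret eet]] _]].
{ now rewrite lf_usq, lph, vcomp_idl. }
{ now rewrite rf_usq, rph, vcomp_idr. }
destruct (crh _ _ _ (usq (rf s)) (rf s) (vid y)) as [ka [[lka [rka eka]] _]].
{ now rewrite lf_usq, lrh, vcomp_idr. }
{ now rewrite rf_usq, rrh, vcomp_idl. }
assert (d1 : rf (sid N) = lf rh) by now rewrite rf_id, lrh.
assert (d2 : rf ph = lf (scomp (hsq (sid N) rh d1) (runit N)))
  by now rewrite rph, lf_comp, lf_hsq, lf_id, lf_runit, vcomp_idl.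
destruct (cs _ _ _ (scomp (hsq ph _ d2) (lunit N)) (vid x) (vid y))
  as [n [[ln [rn en]] _]].
{ now rewrite lf_comp, lf_hsq, lf_lunit, lph, vcomp_idl, vcomp_idr. }
{ now rewrite rf_comp, rf_hsq, rf_lunit, rf_comp, rf_hsq, rf_runit, rrh,
    vcomp_idl, !vcomp_idr. }
constructor; refine {| eta := et; phi := ph; kappa := ka; rho := rh;
  fold_sq := n |}; try assumption.
- intros e1 e2; rewrite en; f_equal; apply hsq_congr; [reflexivity|].
  f_equal; now apply hsq_congr.
- intros e1 e2 e3.
  assert (right : scomp (hsq s ka e1) (scomp (hsq (sid N) rh d1) (runit N))
                  = scomp (runit M) s).
  { assert (e4 : rf s = lf (usq (rf s))) by now rewrite lf_usq.
    rewrite <- scomp_assoc, scomp_hsq, (hsq_congr _ e4 (scomp_idr s) eka).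
    apply hsq_usq_runit. }
  assert (e5 : rf (usq (lf s)) = lf s) by apply rf_usq.
  set (lhs := scomp (hsq et _ e2) n).
  set (rhs := scomp (hsq _ _ e3) (lunit M)).
  assert (E : scomp lhs s = scomp rhs s).
  { unfold lhs, rhs.
    rewrite scomp_assoc, en, <- scomp_assoc, scomp_hsq.
    rewrite scomp_assoc, <- (hsq_usq_lunit e5), <- scomp_assoc, scomp_hsq.
    f_equal; apply hsq_congr; [now rewrite eet, scomp_idl | assumption]. }
  destruct (cs _ _ _ (scomp rhs s) (vid x) (vid y)) as [c [_ uc]].
  { unfold rhs; now rewrite !lf_comp, lf_hsq, lf_id, lf_lunit, vcomp_idl. }
  { unfold rhs; now rewrite !rf_comp, rf_hsq, rf_runit, rf_lunit, vcomp_idl. }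
  transitivity c; [symmetry|]; apply uc; repeat split; try assumption;
    unfold lhs, rhs.
  + now rewrite lf_comp, lf_hsq, let_, ln, vcomp_idl.
  + now rewrite rf_comp, !rf_hsq, rka, rn, vcomp_idl.
  + now rewrite lf_comp, lf_hsq, lf_id, lf_lunit, vcomp_idl.
  + now rewrite rf_comp, rf_hsq, rf_runit, rf_lunit, vcomp_idl.
Qed.

(** The constraints of [F] turn the images of the squares into squares of the
    right type: [funit] is composed with the images of [eta] and [kappa], its
    inverse with those of [phi] and [rho], and [fcmp] twice with the image of
    [fold_sq]. *)
Lemma restriction_data_fsq (D C : DoubleCategory) (F : DoubleFunctor D C)
    (x y z w : ob D) (M : hor x y) (N : hor z w) (s : sq M N) :
  restriction_data s -> inhabited (restriction_data (fsq F s)).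
Proof.
intros W.
destruct (funit_inv F z) as [iz Iz], (funit_inv F w) as [iw Iw].
destruct (globular_inverse Iz (funit_glob F z)) as [liz riz].
destruct (globular_inverse Iw (funit_glob F w)) as [liw riw].
destruct Iz as [uiz izu], Iw as [uiw iwu].
destruct (funit_glob F x) as [lux rux], (funit_glob F y) as [luy ruy].
destruct (funit_glob F z) as [luz ruz], (funit_glob F w) as [luw ruw].
destruct (fcmp_glob F N (conjoint W)) as [lc rc].
destruct (fcmp_glob F (companion W) (hcomp N (conjoint W))) as [lc' rc'].
assert (d0 : rf (sid (fhor F (companion W))) = lf (fcmp F N (conjoint W)))
  by now rewrite rf_id, lc.
constructor; refine {|
  eta := scomp (funit F x) (fsq F (eta W));
  phi := scomp (fsq F (phi W)) iz;
  kappa := scomp (funit F y) (fsq F (kappa W));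
  rho := scomp (fsq F (rho W)) iw;
  fold_sq := scomp (hsq (sid _) (fcmp F N (conjoint W)) d0)
    (scomp (fcmp F (companion W) (hcomp N (conjoint W))) (fsq F (fold_sq W)))
|}.
- now rewrite lf_comp, lux, lf_fsq, lf_eta, fver_id, vcomp_idl.
- now rewrite rf_comp, rux, !rf_fsq, rf_eta, lf_fsq, vcomp_idl.
- now rewrite lf_comp, liz, !lf_fsq, lf_phi, vcomp_idr.
- now rewrite rf_comp, riz, rf_fsq, rf_phi, fver_id, vcomp_idl.
- now rewrite lf_comp, luy, !lf_fsq, lf_kappa, rf_fsq, vcomp_idl.
- now rewrite rf_comp, ruy, rf_fsq, rf_kappa, fver_id, vcomp_idl.
- now rewrite lf_comp, liw, lf_fsq, lf_rho, fver_id, vcomp_idl.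
- now rewrite rf_comp, riw, !rf_fsq, rf_rho, vcomp_idr.
- rewrite lf_fsq, scomp_assoc, <- (scomp_assoc _ _ iz), <- fsq_comp, eta_phi.
  now rewrite <- scomp_assoc, <- funit_nat, scomp_assoc, uiz, scomp_idr.
- rewrite rf_fsq, scomp_assoc, <- (scomp_assoc _ _ iw), <- fsq_comp, kappa_rho.
  now rewrite <- scomp_assoc, <- funit_nat, scomp_assoc, uiw, scomp_idr.
- now rewrite !lf_comp, lf_hsq, lf_id, lc', lf_fsq, lf_fold, fver_id, !vcomp_idl.
- now rewrite !rf_comp, rf_hsq, rc, rc', rf_fsq, rf_fold, fver_id, !vcomp_idl.
(* Compatibility with [fsq F s]: the unit axioms of [F] turn the image of each
   unit constraint of [N] into a unit constraint of [fhor F N]. *)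
- intros e1 e2.
  assert (d1 : rf (sid N) = lf (rho W)) by now rewrite rf_id, lf_rho.
  assert (d2 : rf (phi W) = lf (scomp (hsq (sid N) (rho W) d1) (runit N)))
    by now rewrite rf_phi, lf_comp, lf_hsq, lf_id, lf_runit, vcomp_idl.
  assert (d3 : rf (fsq F (sid N)) = lf (fsq F (rho W)))
    by now rewrite rf_fsq, lf_fsq, d1.
  assert (d4 : rf (fsq F (phi W))
    = lf (fsq F (scomp (hsq (sid N) (rho W) d1) (runit N))))
    by now rewrite rf_fsq, lf_fsq, d2.
  assert (d5 : rf (funit F z) = lf (sid (fhor F N))) by now rewrite ruz, lf_id.
  assert (d6 : rf iz = lf (sid (fhor F N))) by now rewrite riz, lf_id.
  assert (d7 : rf (sid (fhor F N)) = lf (funit F w)) by now rewrite luw, rf_id.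
  assert (d8 : rf (sid (fhor F N)) = lf iw) by now rewrite liw, rf_id.
  assert (L : scomp (fcmp F (hunit z) N) (fsq F (lunit N))
              = scomp (hsq iz (sid (fhor F N)) d6) (lunit (fhor F N))).
  { rewrite <- (fcmp_lunit d5), <- (scomp_assoc (hsq _ _ d6)), scomp_hsq.
    rewrite (hsq_congr _ (eq_trans (rf_id _) (eq_sym (lf_id _))) izu
      (scomp_idl _)).
    now rewrite hsq_id, scomp_idl. }
  assert (Rt : scomp (fcmp F N (hunit w)) (fsq F (runit N))
              = scomp (hsq (sid (fhor F N)) iw d8) (runit (fhor F N))).
  { rewrite <- (fcmp_runit d7), <- (scomp_assoc (hsq _ _ d8)), scomp_hsq.
    rewrite (hsq_congr _ (eq_trans (rf_id _) (eq_sym (lf_id _)))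
      (scomp_idl _) iwu).
    now rewrite hsq_id, scomp_idl. }
  rewrite !scomp_assoc, <- fsq_comp, (fold_s d2), fsq_comp.
  rewrite <- (scomp_assoc (fcmp F _ _)), <- (fcmp_nat d2 d4), !scomp_assoc, L.
  rewrite <- !scomp_assoc, !scomp_hsq.
  f_equal; apply hsq_congr; [now rewrite scomp_idl|].
  rewrite scomp_idr, fsq_comp, <- scomp_assoc, <- (fcmp_nat d1 d3).
  rewrite scomp_assoc, Rt, <- scomp_assoc, scomp_hsq.
  f_equal; apply hsq_congr; [|reflexivity].
  now rewrite scomp_idr, fsq_id.
(* Retraction: [fcmp_nat] gathers everything under one [fsq F], where the
   equation in [D] applies, and the unit axioms of [F] undo the constraints. *)
- intros e1 e2 e3.
  assert (d1 : rf s = lf (kappa W)) by now rewrite lf_kappa.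
  assert (d2 : rf (eta W) = lf (hsq s (kappa W) d1)) by now rewrite rf_eta, lf_hsq.
  assert (d3 : rf (sid (hunit x)) = lf (runit M)) by now rewrite rf_id, lf_runit.
  assert (d4 : rf (fsq F s) = lf (fsq F (kappa W)))
    by now rewrite rf_fsq, lf_fsq, d1.
  assert (d5 : rf (fsq F (eta W)) = lf (fsq F (hsq s (kappa W) d1)))
    by now rewrite rf_fsq, lf_fsq, d2.
  assert (d6 : rf (sid (fhor F M)) = lf (funit F y)) by now rewrite luy, rf_id.
  assert (d7 : rf (funit F x) = lf (sid (fhor F M))) by now rewrite rux, lf_id.
  assert (d8 : rf (fsq F (sid (hunit x))) = lf (fsq F (runit M)))
    by now rewrite rf_fsq, lf_fsq, d3.
  set (m := scomp (hsq (sid (fhor F M)) (funit F y) d6) (fcmp F M (hunit y))).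
  assert (d9 : rf (funit F x) = lf m).
  { unfold m; rewrite rux, lf_comp, lf_hsq, lf_id, vcomp_idl.
    symmetry; apply fcmp_glob. }
  assert (E : scomp (hsq _ _ e2)
      (hsq (sid _) (fcmp F N (conjoint W)) d0)
    = scomp (hsq (funit F x) m d9)
        (hsq (fsq F (eta W)) (fsq F (hsq s (kappa W) d1)) d5)).
  { rewrite !scomp_hsq; apply hsq_congr; [apply scomp_idr|].
    unfold m; rewrite scomp_assoc, <- (fcmp_nat d1 d4), <- scomp_assoc.
    rewrite scomp_hsq; f_equal; apply hsq_congr; [|reflexivity].
    now rewrite scomp_idl. }
  rewrite <- (scomp_assoc (hsq _ _ e2)), E, scomp_assoc.
  rewrite <- (scomp_assoc (hsq _ _ d5)), (fcmp_nat d2 d5), scomp_assoc.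
  rewrite <- fsq_comp, (unfold_fold d2 d3), fsq_comp.
  rewrite <- (scomp_assoc (fcmp F _ _)), <- (fcmp_nat d3 d8).
  rewrite <- (fcmp_lunit d7), <- !scomp_assoc.
  f_equal; f_equal; rewrite !scomp_hsq; apply hsq_congr.
  + now rewrite fsq_id, scomp_idl, scomp_idr.
  + unfold m; rewrite scomp_assoc, fcmp_runit; symmetry; apply scomp_idr.
Qed.

(** * Preservation and reflection of fully faithful morphisms *)

Theorem cartesian_fsq (D C : DoubleCategory) (F : DoubleFunctor D C)
    (x y z w : ob D) (M : hor x y) (N : hor z w) (s : sq M N) :
  has_restrictions D -> cartesian s -> cartesian (fsq F s).
Proof.
intros R cs.
destruct (cartesian_restriction_data R cs) as [W].
destruct (restriction_data_fsq F W) as [W'].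
exact (restriction_data_cartesian W').
Qed.

Lemma invertible_cartesian (C : DoubleCategory) (x y z w : ob C)
    (M : hor x y) (N : hor z w) (a : sq M N) : invertible a -> cartesian a.
Proof.
intros [a' [aa' a'a]] x' y' P b u v eu ev.
exists (scomp b a'); split; [split; [|split]|].
- rewrite lf_comp, eu, vcomp_assoc, <- lf_comp, aa', lf_id; apply vcomp_idr.
- rewrite rf_comp, ev, vcomp_assoc, <- rf_comp, aa', rf_id; apply vcomp_idr.
- now rewrite scomp_assoc, a'a, scomp_idr.
- intros c [_ [_ <-]]; now rewrite scomp_assoc, aa', scomp_idr.
Qed.

(** The unit constraints of [F] are invertible squares relating the two unit
    squares. *)
Lemma ff_ver_fver_iff (D C : DoubleCategory) (F : DoubleFunctor D C)
    (x y : ob D) (f : ver x y) :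
  ff_ver (fver F f) <-> cartesian (fsq F (usq f)).
Proof.
destruct (funit_inv F x) as [ix Ix], (funit_inv F y) as [iy Iy].
assert (E : usq (fver F f) = scomp (funit F x) (scomp (fsq F (usq f)) iy)).
{ rewrite <- scomp_assoc, <- funit_nat, scomp_assoc.
  destruct Iy as [h _]; now rewrite h, scomp_idr. }
assert (E' : fsq F (usq f) = scomp ix (scomp (usq (fver F f)) (funit F y))).
{ rewrite funit_nat, <- scomp_assoc.
  destruct Ix as [_ h]; now rewrite h, scomp_idl. }
unfold ff_ver; split; intro c; [rewrite E' | rewrite E];
  repeat apply cartesian_scomp; auto; apply invertible_cartesian.
- exists (funit F x); now apply inverse_squares_sym.
- apply funit_inv.
- apply funit_inv.
- exists (funit F y); now apply inverse_squares_sym.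
Qed.

Lemma ff_ver_fver (D C : DoubleCategory) (F : DoubleFunctor D C)
    (x y : ob D) (f : ver x y) :
  has_restrictions D -> ff_ver f -> ff_ver (fver F f).
Proof. intros R cf; apply ff_ver_fver_iff; now apply cartesian_fsq. Qed.

Lemma cartesian_comparison_invertible (C : DoubleCategory) (x y z w : ob C)
    (M M' : hor x y) (N : hor z w) (a : sq M N) (a' : sq M' N) (c : sq M M') :
  cartesian a -> cartesian a' -> globular c -> scomp c a' = a -> invertible c.
Proof.
intros ca ca' [lc rc] e.
assert (l : lf a' = vcomp (vid x) (lf a))
  by now rewrite <- e, lf_comp, lc, !vcomp_idl.
assert (r : rf a' = vcomp (vid y) (rf a))
  by now rewrite <- e, rf_comp, rc, !vcomp_idl.
destruct (ca _ _ _ a' _ _ l r) as [d [[ld [rd ed]] _]].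
exists d; split.
- destruct (ca _ _ _ a (vid x) (vid y)) as [k [_ uk]];
    [now rewrite vcomp_idl..|].
  transitivity k; [symmetry|]; apply uk.
  + rewrite lf_comp, rf_comp, lc, rc, ld, rd, !vcomp_idl, scomp_assoc, ed; auto.
  + rewrite lf_id, rf_id, scomp_idl; auto.
- destruct (ca' _ _ _ a' (vid x) (vid y)) as [k [_ uk]];
    [now rewrite vcomp_idl..|].
  transitivity k; [symmetry|]; apply uk.
  + rewrite lf_comp, rf_comp, lc, rc, ld, rd, !vcomp_idl, scomp_assoc, e; auto.
  + rewrite lf_id, rf_id, scomp_idl; auto.
Qed.

Definition reflects_globular_isos (D C : DoubleCategory)
    (F : DoubleFunctor D C) : Prop :=
  forall (x y : ob D) (M N : hor x y) (a : sq M N),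
  globular a -> invertible (fsq F a) -> invertible a.

(** [usq f] is [c] followed by a restriction [r], so it is enough that [c] be
    invertible; its image is, as a comparison between two cartesian squares. *)
Lemma ff_ver_reflect (D C : DoubleCategory) (F : DoubleFunctor D C)
    (x y : ob D) (f : ver x y) :
  has_restrictions D -> reflects_globular_isos F ->
  ff_ver (fver F f) -> ff_ver f.
Proof.
intros R refl cFf; apply ff_ver_fver_iff in cFf.
destruct (R _ _ _ _ f f (hunit y)) as [M [r [lr [rr cr]]]].
destruct (cr _ _ _ (usq f) (vid x) (vid x)) as [c [[lc [rc ec]] _]].
{ now rewrite lf_usq, lr, vcomp_idl. }
{ now rewrite rf_usq, rr, vcomp_idl. }
unfold ff_ver; rewrite <- ec; apply cartesian_scomp; [|exact cr].
apply invertible_cartesian, refl; [now split|].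
apply (cartesian_comparison_invertible cFf (cartesian_fsq (F := F) R cr)).
- apply globular_fsq; now split.
- now rewrite <- fsq_comp, ec.
Qed.

(** * The vertical opposite *)

Section Inverses.
Context {C : DoubleCategory}.

(** The coherence squares are only assumed to have an inverse, while those of an
    opposite have to be given. *)
Definition inv_sq (x y x' y' : ob C) (M : hor x y) (N : hor x' y')
    (a : sq M N) (i : invertible a) : sq N M :=
  proj1_sig (constructive_indefinite_description _ i).

Lemma inv_sqP (x y x' y' : ob C) (M : hor x y) (N : hor x' y')
    (a : sq M N) (i : invertible a) : inverse_squares a (inv_sq i).
Proof. exact (proj2_sig (constructive_indefinite_description _ i)). Qed.

Lemma inverse_squares_unique (x y x' y' : ob C) (M : hor x y) (N : hor x' y')
    (a a' : sq M N) (b b' : sq N M) :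
  inverse_squares a b -> inverse_squares a' b' -> a = a' -> b = b'.
Proof.
intros [_ ba] [ab' _] <-.
rewrite <- (scomp_idr b), <- ab', <- scomp_assoc, ba; apply scomp_idl.
Qed.

Lemma inverse_squares_scomp (x y x' y' x'' y'' : ob C) (M : hor x y)
    (N : hor x' y') (P : hor x'' y'') (a : sq M N) (b : sq N P)
    (a' : sq N M) (b' : sq P N) :
  inverse_squares a a' -> inverse_squares b b' ->
  inverse_squares (scomp a b) (scomp b' a').
Proof.
intros [a1 a2] [b1 b2]; split.
- rewrite scomp_assoc, <- (scomp_assoc b), b1, scomp_idl; exact a1.
- rewrite scomp_assoc, <- (scomp_assoc a'), a2, scomp_idl; exact b2.
Qed.

Lemma inverse_squares_hsq (x y z x' y' z' : ob C)
    (M : hor x y) (N : hor y z) (M' : hor x' y') (N' : hor y' z')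
    (a : sq M M') (b : sq N N') (a' : sq M' M) (b' : sq N' N)
    (e : rf a = lf b) (e' : rf a' = lf b') :
  inverse_squares a a' -> inverse_squares b b' ->
  inverse_squares (hsq a b e) (hsq a' b' e').
Proof.
assert (k : forall (u v : ob C) (P : hor u v) (w : ob C) (Q : hor v w),
  rf (sid P) = lf (sid Q)) by (intros; now rewrite rf_id, lf_id).
intros [a1 a2] [b1 b2]; split; rewrite scomp_hsq.
- rewrite (hsq_congr _ (k _ _ _ _ _) a1 b1); apply hsq_id.
- rewrite (hsq_congr _ (k _ _ _ _ _) a2 b2); apply hsq_id.
Qed.

(** Inverses of the components of a natural isomorphism are natural. *)
Lemma inverse_squares_nat (x y z w x' y' z' w' : ob C)
    (M : hor x y) (N : hor z w) (M' : hor x' y') (N' : hor z' w')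
    (t : sq M N) (t' : sq M' N') (i : sq N M) (i' : sq N' M')
    (a : sq M M') (b : sq N N') :
  inverse_squares t i -> inverse_squares t' i' ->
  scomp a t' = scomp t b -> scomp b i' = scomp i a.
Proof.
intros [_ it] [ti' _] e.
rewrite <- (scomp_idl b), <- it, (scomp_assoc i), <- e, !scomp_assoc, ti'.
now rewrite scomp_idr.
Qed.

Lemma inverse_squares_fsq (D : DoubleCategory) (F : DoubleFunctor D C)
    (x y x' y' : ob D) (M : hor x y) (N : hor x' y') (a : sq M N) (b : sq N M) :
  inverse_squares a b -> inverse_squares (fsq F a) (fsq F b).
Proof.
intros [ab ba]; split; rewrite <- fsq_comp; [rewrite ab | rewrite ba];
  apply fsq_id.
Qed.

Lemma inv_sq_globular (x y : ob C) (M N : hor x y) (a : sq M N)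
    (i : invertible a) : globular a -> globular (inv_sq i).
Proof. apply globular_inverse, inv_sqP. Qed.

End Inverses.

(** Reversing vertical composition inverts the coherence squares; each coherence
    law becomes the equality of the inverses of its two sides. *)
Definition vop (C : DoubleCategory) : DoubleCategory.
Proof.
refine {|
  ob := ob C;
  ver := fun x y => @ver C y x;
  vid := @vid C;
  vcomp := fun x y z f g => vcomp g f;
  hor := @hor C;
  sq := fun x y x' y' M M' => @sq C x' y' x y M' M;
  sid := @sid C;
  scomp := fun _ _ _ _ _ _ _ _ _ a b => scomp b a;
  lf := fun _ _ _ _ _ _ a => lf a;
  rf := fun _ _ _ _ _ _ a => rf a;
  hunit := @hunit C;
  usq := fun x y f => usq f;
  hcomp := @hcomp C;
  hsq := fun _ _ _ _ _ _ _ _ _ _ a b e => hsq a b e;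
  assoc := fun _ _ _ _ M N P => inv_sq (assoc_inv M N P);
  lunit := fun _ _ M => inv_sq (lunit_inv M);
  runit := fun _ _ M => inv_sq (runit_inv M)
|}; intros.
- apply vcomp_idr.
- apply vcomp_idl.
- symmetry; apply vcomp_assoc.
- apply scomp_idr.
- apply scomp_idl.
- symmetry; apply scomp_assoc.
- apply lf_id.
- apply rf_id.
- apply lf_comp.
- apply rf_comp.
- apply lf_usq.
- apply rf_usq.
- apply usq_id.
- apply usq_comp.
- apply lf_hsq.
- apply rf_hsq.
- apply hsq_id.
- apply hsq_comp.
- apply (inv_sq_globular _ (conj (lf_assoc M N P) (rf_assoc M N P))).
- apply (inv_sq_globular _ (conj (lf_assoc M N P) (rf_assoc M N P))).
- exists (assoc M N P); apply inv_sqP.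
- symmetry; eapply inverse_squares_nat; [apply inv_sqP..|]; apply assoc_nat.
- apply (inv_sq_globular _ (conj (lf_lunit M) (rf_lunit M))).
- apply (inv_sq_globular _ (conj (lf_lunit M) (rf_lunit M))).
- exists (lunit M); apply inv_sqP.
- symmetry; eapply inverse_squares_nat; [apply inv_sqP..|]; apply lunit_nat.
- apply (inv_sq_globular _ (conj (lf_runit M) (rf_runit M))).
- apply (inv_sq_globular _ (conj (lf_runit M) (rf_runit M))).
- exists (runit M); apply inv_sqP.
- symmetry; eapply inverse_squares_nat; [apply inv_sqP..|]; apply runit_nat.
- assert (d1 : rf (assoc M N P) = lf (sid Q)) by now rewrite rf_assoc, lf_id.
  assert (d2 : rf (sid M) = lf (assoc N P Q)) by now rewrite lf_assoc, rf_id.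
  eapply inverse_squares_unique; [| |apply (pentagon d1 d2)];
    repeat apply inverse_squares_scomp; try apply inverse_squares_hsq;
    try apply inv_sqP; apply sid_inverse.
- assert (d1 : rf (sid M) = lf (lunit N)) by now rewrite lf_lunit, rf_id.
  assert (d2 : rf (runit M) = lf (sid N)) by now rewrite rf_runit, lf_id.
  eapply inverse_squares_unique; [| |apply (triangle d1 d2)];
    repeat apply inverse_squares_scomp; try apply inverse_squares_hsq;
    try apply inv_sqP; apply sid_inverse.
Defined.

Definition vop_functor (D C : DoubleCategory) (F : DoubleFunctor D C) :
  DoubleFunctor (vop D) (vop C).
Proof.
refine (@Build_DoubleFunctor (vop D) (vop C)
  (fob F)
  (fun x y f => fver F f) _ _
  (fun x y M => fhor F M)
  (fun _ _ _ _ _ _ a => fsq F a) _ _ _ _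
  (fun x y z M N => inv_sq (fcmp_inv F M N)) _ _ _
  (fun x => inv_sq (funit_inv F x)) _ _ _ _ _ _);
  intros; simpl in *.
- apply fver_id.
- apply fver_comp.
- apply lf_fsq.
- apply rf_fsq.
- apply fsq_id.
- apply fsq_comp.
- apply (inv_sq_globular _ (fcmp_glob F M N)).
- exists (fcmp F M N); exact (inv_sqP (fcmp_inv F M N)).
- symmetry; eapply inverse_squares_nat; [apply inv_sqP..|]; apply fcmp_nat.
- apply (inv_sq_globular _ (funit_glob F x)).
- exists (funit F x); exact (inv_sqP (funit_inv F x)).
- symmetry; eapply inverse_squares_nat; [apply inv_sqP..|]; apply funit_nat.
- assert (d1 : rf (fcmp F M N) = lf (sid (fhor F P))).
  { rewrite lf_id; apply fcmp_glob. }
  assert (d2 : rf (sid (fhor F M)) = lf (fcmp F N P)).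
  { rewrite rf_id; symmetry; apply fcmp_glob. }
  eapply inverse_squares_unique; [| |apply (fcmp_assoc d1 d2)];
    repeat apply inverse_squares_scomp; try apply inverse_squares_hsq;
    try apply inverse_squares_fsq; try apply inv_sqP; apply sid_inverse.
- assert (d1 : rf (funit F x) = lf (sid (fhor F M))).
  { rewrite lf_id; apply funit_glob. }
  eapply inverse_squares_unique; [| |apply (fcmp_lunit d1)];
    repeat apply inverse_squares_scomp; try apply inverse_squares_hsq;
    try apply inverse_squares_fsq; try apply inv_sqP; apply sid_inverse.
- assert (d1 : rf (sid (fhor F M)) = lf (funit F y)).
  { rewrite rf_id; symmetry; apply funit_glob. }
  eapply inverse_squares_unique; [| |apply (fcmp_runit d1)];
    repeat apply inverse_squares_scomp; try apply inverse_squares_hsq;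
    try apply inverse_squares_fsq; try apply inv_sqP; apply sid_inverse.
Defined.

(** * Preservation and reflection of absolutely dense morphisms *)

Definition has_extensions (D : DoubleCategory) : Prop :=
  forall (x y z w : ob D) (f : ver x z) (g : ver y w) (M : hor x y),
  exists (N : hor z w) (a : sq M N), lf a = f /\ rf a = g /\ opcartesian a.

Lemma has_extensions_vop (D : DoubleCategory) :
  has_extensions D -> has_restrictions (vop D).
Proof. intros E x y z w f g N; exact (E _ _ _ _ f g N). Qed.

Lemma ad_ver_fver (D C : DoubleCategory) (F : DoubleFunctor D C)
    (x y : ob D) (f : ver x y) :
  has_extensions D -> ad_ver f -> ad_ver (fver F f).
Proof.
intros E c.
exact (ff_ver_fver (F := vop_functor F) (f := f : @ver (vop D) y x)
  (has_extensions_vop E) c).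
Qed.

Lemma ad_ver_reflect (D C : DoubleCategory) (F : DoubleFunctor D C)
    (x y : ob D) (f : ver x y) :
  has_extensions D -> reflects_globular_isos F ->
  ad_ver (fver F f) -> ad_ver f.
Proof.
intros E refl c.
refine (ff_ver_reflect (F := vop_functor F) (f := f : @ver (vop D) y x)
  (has_extensions_vop E) _ c).
intros x' y' M N a ga [b Ib].
destruct (refl x' y' N M a ga) as [d Id].
- exists b; exact (inverse_squares_sym Ib).
- exists d; exact (inverse_squares_sym Id).
Qed.

(** * Factorization through a sub-double category *)

(** Functors agreeing definitionally on cells are equal as soon as their
    constraints are; this is the situation of a corestriction. *)
Lemma double_functor_ext (D C : DoubleCategory) o v vi vc h s sl sr si sc
    c cg ci cn u ug ui un ca cl cr c' cg' ci' cn' u' ug' ui' un' ca' cl' cr'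
    vi' vc' sl' sr' si' sc' :
  c = c' -> u = u' ->
  @Build_DoubleFunctor D C o v vi vc h s sl sr si sc
    c cg ci cn u ug ui un ca cl cr
  = @Build_DoubleFunctor D C o v vi' vc' h s sl' sr' si' sc'
    c' cg' ci' cn' u' ug' ui' un' ca' cl' cr'.
Proof.
intros <- <-.
destruct (proof_irrelevance _ vi vi').
destruct (proof_irrelevance _ vc vc').
destruct (proof_irrelevance _ sl sl').
destruct (proof_irrelevance _ sr sr').
destruct (proof_irrelevance _ si si').
destruct (proof_irrelevance _ sc sc').
destruct (proof_irrelevance _ cg cg').
destruct (proof_irrelevance _ ci ci').
destruct (proof_irrelevance _ cn cn').
destruct (proof_irrelevance _ ug ug').
destruct (proof_irrelevance _ ui ui').
destruct (proof_irrelevance _ un un').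
destruct (proof_irrelevance _ ca ca').
destruct (proof_irrelevance _ cl cl').
destruct (proof_irrelevance _ cr cr').
reflexivity.
Qed.

Section Corestriction.
Variables (D C : DoubleCategory) (S : SubDouble C).

(** The inverses of the constraints are included because a sub-double category
    need not contain the inverse of an invertible square of its own. *)
Record lands_in (F : DoubleFunctor D C) : Prop := {
  lands_ob : forall x : ob D, sob S (fob F x);
  lands_ver : forall (x y : ob D) (f : ver x y), sver S (fver F f);
  lands_hor : forall (x y : ob D) (M : hor x y), shor S (fhor F M);
  lands_sq : forall (x y x' y' : ob D) (M : hor x y) (M' : hor x' y')
    (a : sq M M'), ssq S (fsq F a);
  lands_cmp : forall (x y z : ob D) (M : hor x y) (N : hor y z),
    ssq S (fcmp F M N);
  lands_cmp_inv : forall (x y z : ob D) (M : hor x y) (N : hor y z) b,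
    inverse_squares (fcmp F M N) b -> ssq S b;
  lands_unit : forall x : ob D, ssq S (funit F x);
  lands_unit_inv : forall (x : ob D) b,
    inverse_squares (funit F x) b -> ssq S b
}.

Definition corestrict (F : DoubleFunctor D C) (L : lands_in F) :
  DoubleFunctor D (sub_double S).
Proof.
refine (@Build_DoubleFunctor D (sub_double S)
  (fun x => mk (fob F x) (lands_ob L x))
  (fun x y f => mk (fver F f) (lands_ver L f)) _ _
  (fun x y M => mk (fhor F M) (lands_hor L M))
  (fun _ _ _ _ _ _ a => mk (fsq F a) (lands_sq L a)) _ _ _ _
  (fun x y z M N => mk (fcmp F M N) (lands_cmp L M N)) _ _ _
  (fun x => mk (funit F x) (lands_unit L x)) _ _ _ _ _ _); intros.
- apply sub_eq, fver_id.
- apply sub_eq, fver_comp.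
- apply sub_eq, lf_fsq.
- apply sub_eq, rf_fsq.
- apply sub_eq, fsq_id.
- apply sub_eq, fsq_comp.
- split; apply sub_eq, fcmp_glob.
- destruct (fcmp_inv F M N) as [b Ib].
  exists (mk b (lands_cmp_inv L Ib)); split; apply sub_eq, Ib.
- apply sub_eq, (fcmp_nat e (f_equal val e')).
- split; apply sub_eq, funit_glob.
- destruct (funit_inv F x) as [b Ib].
  exists (mk b (lands_unit_inv L Ib)); split; apply sub_eq, Ib.
- apply sub_eq, funit_nat.
- apply sub_eq, (fcmp_assoc (f_equal val e1) (f_equal val e2)).
- apply sub_eq, (fcmp_lunit (f_equal val e)).
- apply sub_eq, (fcmp_runit (f_equal val e)).
Defined.

Lemma corestrict_inclusion (F : DoubleFunctor D C) (L : lands_in F) :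
  compose_functor (corestrict L) (sub_inclusion S) = F.
Proof.
destruct F; apply double_functor_ext.
- repeat (apply functional_extensionality_dep; intro); apply scomp_idl.
- repeat (apply functional_extensionality_dep; intro); apply scomp_idl.
Qed.

(** Transparent, with the membership proofs that [G] carries: by eta for [sub],
    corestricting the composite then returns the cells of [G] definitionally. *)
Lemma lands_in_inclusion (G : DoubleFunctor D (sub_double S)) :
  lands_in (compose_functor G (sub_inclusion S)).
Proof.
split; intros.
- exact (prf (fob G x)).
- exact (prf (fver G f)).
- exact (prf (fhor G M)).
- exact (prf (fsq G a)).
- apply ssq_comp; [apply ssq_id, shor_comp|]; exact (prf _).
- destruct (fcmp_inv G M N) as [d [cd dc]].
  simpl in H; rewrite scomp_idl in H.
  rewrite (inverse_squares_unique (b' := val d) H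
    (conj (f_equal val cd) (f_equal val dc)) eq_refl).
  exact (prf d).
- apply ssq_comp; [apply ssq_id, shor_unit|]; exact (prf _).
- destruct (funit_inv G x) as [d [cd dc]].
  simpl in H; rewrite scomp_idl in H.
  rewrite (inverse_squares_unique (b' := val d) H
    (conj (f_equal val cd) (f_equal val dc)) eq_refl).
  exact (prf d).
Defined.

Lemma corestrict_compose (G : DoubleFunctor D (sub_double S))
    (L : lands_in (compose_functor G (sub_inclusion S))) :
  corestrict L = G.
Proof.
rewrite (proof_irrelevance _ L (lands_in_inclusion G)).
destruct G; apply double_functor_ext.
- repeat (apply functional_extensionality_dep; intro); apply sub_eq, scomp_idl.
- repeat (apply functional_extensionality_dep; intro); apply sub_eq, scomp_idl.
Qed.

Theorem unique_factorization (F : DoubleFunctor D C) :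
  lands_in F ->
  exists! G : DoubleFunctor D (sub_double S),
    compose_functor G (sub_inclusion S) = F.
Proof.
intro L; exists (corestrict L); split; [apply corestrict_inclusion|].
intros G E; subst F; apply corestrict_compose.
Qed.

End Corestriction.

(** * Sub-framed bicategories inside a sub-double category *)

Section Nested.
Variables (C : DoubleCategory) (W S : SubDouble C).
Hypothesis ob_le : forall x : ob C, sob S x -> sob W x.
Hypothesis ver_le : forall (x y : ob C) (f : ver x y), sver S f -> sver W f.
Hypothesis hor_le : forall (x y : ob C) (M : hor x y), shor S M -> shor W M.
Hypothesis sq_le : forall (x y x' y' : ob C) (M : hor x y) (M' : hor x' y')
  (a : sq M M'), ssq S a -> ssq W a.

Definition nested : SubDouble (sub_double W).
Proof.
refine {|
  sob := fun x : ob (sub_double W) => sob S (val x);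
  sver := fun (x y : ob (sub_double W)) (f : ver x y) => sver S (val f);
  shor := fun (x y : ob (sub_double W)) (M : hor x y) => shor S (val M);
  ssq := fun (x y x' y' : ob (sub_double W)) (M : hor x y) (M' : hor x' y')
    (a : sq M M') => ssq S (val a)
|}; intros.
- exact (sver_ob H).
- exact (shor_ob H).
- exact (ssq_hor H).
- exact (ssq_lf H).
- exact (ssq_rf H).
- now apply sver_id.
- now apply sver_comp.
- now apply ssq_id.
- now apply ssq_comp.
- now apply shor_unit.
- now apply ssq_usq.
- now apply shor_comp.
- now apply ssq_hsq.
- now apply ssq_assoc.
- apply (ssq_assoc_inv H H0 H1).
  split; [exact (f_equal val (proj1 H2)) | exact (f_equal val (proj2 H2))].
- now apply ssq_lunit.
- apply (ssq_lunit_inv H).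
  split; [exact (f_equal val (proj1 H0)) | exact (f_equal val (proj2 H0))].
- now apply ssq_runit.
- apply (ssq_runit_inv H).
  split; [exact (f_equal val (proj1 H0)) | exact (f_equal val (proj2 H0))].
Defined.

Let flat_ob (x : ob (sub_double nested)) : ob (sub_double S) :=
  mk (val (val x)) (prf x).
Let flat_ver (x y : ob (sub_double nested)) (f : ver x y) :
  ver (flat_ob x) (flat_ob y) := mk (val (val f)) (prf f).
Let flat_hor (x y : ob (sub_double nested)) (M : hor x y) :
  hor (flat_ob x) (flat_ob y) := mk (val (val M)) (prf M).
Let flat_sq (x y x' y' : ob (sub_double nested)) (M : hor x y)
    (M' : hor x' y') (a : sq M M') : sq (flat_hor M) (flat_hor M') :=
  mk (val (val a)) (prf a).

Let nest_hor (x y : ob (sub_double nested)) (M : hor (flat_ob x) (flat_ob y)) :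
  @hor (sub_double nested) x y := mk (mk (val M) (hor_le (prf M))) (prf M).
Let nest_sq (x y x' y' : ob (sub_double nested)) (M : @hor (sub_double nested) x y)
    (M' : @hor (sub_double nested) x' y') (a : sq (flat_hor M) (flat_hor M')) : sq M M' :=
  mk (mk (val a) (sq_le (prf a))) (prf a).

Lemma nested_eq (A : Type) (P : A -> Prop) (Q : sub P -> Prop) (a b : sub Q) :
  val (val a) = val (val b) -> a = b.
Proof. intro e; now apply sub_eq, sub_eq. Qed.

(** Squares of [sub_double nested] are squares of [sub_double S] with a second
    membership proof, so universal properties transfer through [flat_sq] and
    [nest_sq]. *)
Lemma nested_cartesian (x y z w : ob (sub_double nested))
    (M : hor x y) (N : hor z w) (a : sq M N) :
  cartesian (flat_sq a) -> cartesian a.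
Proof.
intros ca x' y' P b u v eu ev.
destruct (ca _ _ (flat_hor P) (flat_sq b) (flat_ver u) (flat_ver v))
  as [c [[lc [rc ec]] uc]].
{ apply sub_eq; exact (f_equal (fun k => val (val k)) eu). }
{ apply sub_eq; exact (f_equal (fun k => val (val k)) ev). }
exists (nest_sq c); split.
- split; [|split]; apply nested_eq.
  + exact (f_equal val lc).
  + exact (f_equal val rc).
  + exact (f_equal val ec).
- intros d [ld [rd ed]]; apply nested_eq.
  refine (f_equal val (uc (flat_sq d) _)).
  split; [|split]; apply sub_eq.
  + exact (f_equal (fun k => val (val k)) ld).
  + exact (f_equal (fun k => val (val k)) rd).
  + exact (f_equal (fun k => val (val k)) ed).
Qed.

Lemma nested_opcartesian (x y z w : ob (sub_double nested))
    (M : hor x y) (N : hor z w) (a : sq M N) :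
  opcartesian (flat_sq a) -> opcartesian a.
Proof.
intros ca z' w' P b u v eu ev.
destruct (ca _ _ (flat_hor P) (flat_sq b) (flat_ver u) (flat_ver v))
  as [c [[lc [rc ec]] uc]].
{ apply sub_eq; exact (f_equal (fun k => val (val k)) eu). }
{ apply sub_eq; exact (f_equal (fun k => val (val k)) ev). }
exists (nest_sq c); split.
- split; [|split]; apply nested_eq.
  + exact (f_equal val lc).
  + exact (f_equal val rc).
  + exact (f_equal val ec).
- intros d [ld [rd ed]]; apply nested_eq.
  refine (f_equal val (uc (flat_sq d) _)).
  split; [|split]; apply sub_eq.
  + exact (f_equal (fun k => val (val k)) ld).
  + exact (f_equal (fun k => val (val k)) rd).
  + exact (f_equal (fun k => val (val k)) ed).
Qed.

Definition nested_framing (R : Framing (sub_double S)) :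
  Framing (sub_double nested).
Proof.
refine {|
  restr := fun (x y z w : ob (sub_double nested)) (f : ver x z) (g : ver y w)
    (N : hor z w) => nest_hor (restr R (flat_ver f) (flat_ver g) (flat_hor N));
  restr_sq := fun (x y z w : ob (sub_double nested)) (f : ver x z) (g : ver y w)
    (N : hor z w) =>
    nest_sq (M := nest_hor _) (restr_sq R (flat_ver f) (flat_ver g) (flat_hor N))
|}; intros.
- apply nested_eq, (f_equal val (lf_restr R (flat_ver f) (flat_ver g) (flat_hor N))).
- apply nested_eq, (f_equal val (rf_restr R (flat_ver f) (flat_ver g) (flat_hor N))).
- apply nested_cartesian, restr_cartesian.
(* [g] sends the normality equation of [R] to the one sought, except that its
   right-hand side carries other membership proofs for [N]. *)
- pose (g := fun p : {M : hor (flat_ob z) (flat_ob w) & sq M (flat_hor N)} =>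
    existT (fun M : hor z w => sq M N) (nest_hor (projT1 p))
      (nest_sq (M := nest_hor (projT1 p)) (projT2 p))).
  refine (eq_trans (f_equal g (restr_normal R (flat_hor N))) _).
  unfold g; simpl.
  destruct N as [[n p] q]; change (shor S n) in q.
  destruct (proof_irrelevance _ (hor_le q) p).
  refine (f_equal (existT (fun M : hor z w => sq M _) _) _).
  now apply nested_eq.
- destruct (opcartesian_lift R (flat_ver f) (flat_ver g) (flat_hor M))
    as [N [a [la [ra ca]]]].
  exists (nest_hor N), (nest_sq (M' := nest_hor N) a); split; [|split].
  + apply nested_eq, (f_equal val la).
  + apply nested_eq, (f_equal val ra).
  + now apply nested_opcartesian.
Defined.

Lemma nested_same_cells : same_cells nested S.
Proof.
split; intros; split.
- intro p; now exists (ob_le p).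
- intros [? p]; exact p.
- intro p; destruct (sver_ob p) as [px py].
  now exists (ob_le px), (ob_le py), (ver_le p).
- intros [? [? [? p]]]; exact p.
- intro p; destruct (shor_ob p) as [px py].
  now exists (ob_le px), (ob_le py), (hor_le p).
- intros [? [? [? p]]]; exact p.
- intro p; destruct (ssq_hor p) as [pM pM'].
  destruct (shor_ob pM) as [px py], (shor_ob pM') as [px' py'].
  now exists (ob_le px), (ob_le py), (ob_le px'), (ob_le py'),
    (hor_le pM), (hor_le pM'), (sq_le p).
- intros [? [? [? [? [? [? [? p]]]]]]]; exact p.
Qed.

Lemma sub_framed_of_le : sub_framed S -> sub_framed_of W S.
Proof.
intros [R]; exists nested; split; [|exact nested_same_cells].
exact (inhabits (nested_framing R)).
Qed.

End Nested.

(** * The factorization theorem *)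

Lemma framing_restrictions (D : DoubleCategory) :
  Framing D -> has_restrictions D.
Proof.
intros R x y z w f g N; exists (restr R f g N), (restr_sq R f g N).
split; [|split]; [apply lf_restr | apply rf_restr | apply restr_cartesian].
Qed.

Lemma framing_extensions (D : DoubleCategory) : Framing D -> has_extensions D.
Proof. intros R x y z w f g M; apply (opcartesian_lift R). Qed.

Section FrameClass.
Variables (C : FramedBicategory) (W : forall x y : ob C, ver x y -> Prop).
Hypothesis W_id : forall x : ob C, W (vid x).
Hypothesis W_comp : forall (x y z : ob C) (f : ver x y) (g : ver y z),
  W f -> W g -> W (vcomp f g).

Lemma lands_in_spanned (D : DoubleCategory)
    (F : DoubleFunctor D C) :
  (forall (x y : ob D) (f : ver x y), W (fver F f)) ->
  lands_in (spanned W_id W_comp) F.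
Proof.
intro WF; split; intros; simpl; try exact I.
- apply WF.
- now rewrite lf_fsq, rf_fsq.
- destruct (fcmp_glob F M N) as [l r]; now rewrite l, r.
- exact (inverse_frames W_id (fcmp_glob F M N) H).
- destruct (funit_glob F x) as [l r]; now rewrite l, r.
- exact (inverse_frames W_id (funit_glob F x) H).
Qed.

(** [spanned] is full over the class [W], so only vertical morphisms have to be
    tested. *)
Lemma sub_framed_of_spanned (D : SubDouble C) :
  sub_framed D ->
  (sub_framed_of (spanned W_id W_comp) D <->
   forall (x y : ob C) (f : ver x y), sver D f -> W f).
Proof.
intro FD; split.
- intros [T [_ E]] x y f p.
  now destruct (proj1 (same_ver E f) p) as [_ [_ [q _]]].
- intro WD; apply sub_framed_of_le; simpl; auto.
  intros; split; apply WD; [eapply ssq_lf | eapply ssq_rf]; eassumption.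
Qed.

End FrameClass.

Lemma sub_inclusion_reflects (C : DoubleCategory) (S : SubDouble C) :
  closed_under_globular_inverses S ->
  reflects_globular_isos (sub_inclusion S).
Proof.
intros cl x y M N a [la ra] [b Ib].
assert (ga : globular (val a)).
{ split; [exact (f_equal val la) | exact (f_equal val ra)]. }
exists (mk b (cl _ _ _ _ _ _ ga Ib (prf a))).
split; apply sub_eq; apply Ib.
Qed.

Theorem proposition4p7 (C : FramedBicategory) :
  ((forall (D : FramedBicategory) (F : StrongFramedFunctor D C),
      fully_faithful D ->
      exists! F' : StrongFramedFunctor D (tilde C),
        compose_functor F' (tilde_inclusion C) = F) /\
   (forall D : SubDouble C, sub_framed D ->
      (fully_faithful (sub_double D) -> sub_framed_of (tilde_sub C) D) /\
      (closed_under_globular_inverses D ->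
       sub_framed_of (tilde_sub C) D -> fully_faithful (sub_double D))))
  /\
  ((forall (D : FramedBicategory) (F : StrongFramedFunctor D C),
      absolutely_dense D ->
      exists! F' : StrongFramedFunctor D (hat C),
        compose_functor F' (hat_inclusion C) = F) /\
   (forall D : SubDouble C, sub_framed D ->
      (absolutely_dense (sub_double D) -> sub_framed_of (hat_sub C) D) /\
      (closed_under_globular_inverses D ->
       sub_framed_of (hat_sub C) D -> absolutely_dense (sub_double D)))).
Proof.
split; split.
- intros D F ffD.
  apply unique_factorization, lands_in_spanned; intros x y f.
  apply ff_ver_fver; [exact (framing_restrictions (framing D)) | apply ffD].
- intros D FD; destruct (FD) as [R]; apply framing_restrictions in R.
  split.
  + intro ffD; apply sub_framed_of_spanned; [exact FD|]; intros x y f p.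
    destruct (sver_ob p) as [px py].
    exact (ff_ver_fver (F := sub_inclusion D) R (ffD (mk x px) (mk y py) (mk f p))).
  + intros cl WD x y f.
    apply (ff_ver_reflect R (sub_inclusion_reflects cl)).
    exact (proj1 (sub_framed_of_spanned _ _ FD) WD _ _ _ (prf f)).
- intros D F adD.
  apply unique_factorization, lands_in_spanned; intros x y f.
  apply ad_ver_fver; [exact (framing_extensions (framing D)) | apply adD].
- intros D FD; destruct (FD) as [R]; apply framing_extensions in R.
  split.
  + intro adD; apply sub_framed_of_spanned; [exact FD|]; intros x y f p.
    destruct (sver_ob p) as [px py].
    exact (ad_ver_fver (F := sub_inclusion D) R (adD (mk x px) (mk y py) (mk f p))).
  + intros cl WD x y f.
    apply (ad_ver_reflect R (sub_inclusion_reflects cl)).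
    exact (proj1 (sub_framed_of_spanned _ _ FD) WD _ _ _ (prf f)).
Qed.
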